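(* Let $(p,<)$ be a weakly o-minimal pair over $A$ and let $\triangleleft$ be a relatively $A$-definable linear order on $p(\mathfrak C)$. Then there exists a unique strictly $\subseteq$-increasing sequence $\vec E=(E_0,E_1,\dots,E_n)\in\mathcal E_p^{\,n+1}$ such that $E_0=\mathrm{id}_{p(\mathfrak C)}$ and $\triangleleft=<_{\vec E}$. Moreover, $<$ and $\triangleleft$ have the same orientation if and only if $E_n\neq\mathbf 1_p$.
   Context: $T$ complete (possibly multi-sorted), monster model $\mathfrak C$, $A$ small. For a partial type $p$ over $A$, $p(\mathfrak C)$ is its realization set; relatively $B$-definable subsets/relations of $p(\mathfrak C)$ are traces of $B$-definable sets. $(p,<)$, with $p\in S(A)$ and $<$ a relatively $A$-definable linear order on $p(\mathfrak C)$, is a weakly o-minimal pair over $A$ if every relatively definable (any parameters) subset of $p(\mathfrak C)$ has finitely many convex components in $(p(\mathfrak C),<)$. $\mathcal E_p$ is the set of relatively $A$-definable equivalence relations on $p(\mathfrak C)$ (all of them are $<$-convex and pairwise $\subseteq$-comparable); $\mathrm{id}_{p(\mathfrak C)}$ is the identity and $\mathbf 1_p=p(\mathfrak C)^2$. For a convex equivalence relation $E$, $x<_E y$ iff $(E(x,y)\wedge y<x)\vee(\neg E(x,y)\wedge x<y)$; for $\vec E=(E_0,\dots,E_n)$ pairwise comparable convex, $<_{\vec E}=(\cdots(<_{E_0})_{E_1}\cdots)_{E_n}$. A subset of $(p(\mathfrak C),<)$ is right-eventual if it contains a nonempty final segment. The order $\triangleleft$ has the same orientation as $<$ if for some (equivalently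 all) $a\models p$ the set $\{x\in p(\mathfrak C): a\triangleleft x\}$ is right-eventual in $(p(\mathfrak C),<)$. *)

(* Defs.v *)
From mathcomp Require Import all_boot.
From mathcomp Require Import boolp classical_sets functions cardinality.

Set Implicit Arguments.
Unset Strict Implicit.
Unset Printing Implicit Defensive.

Local Open Scope classical_set_scope.
Local Open Scope card_scope.

(** * Multi-sorted first-order logic *)

Record language := Language {
  sorts : Type;
  fsym : Type;
  farity : fsym -> nat;
  fdom : forall f : fsym, 'I_(farity f) -> sorts;
  fcod : fsym -> sorts;
  rsym : Type;
  rarity : rsym -> nat;
  rdom : forall r : rsym, 'I_(rarity r) -> sorts }.

(* Variables come as a sort-indexed family [V]: [V s] is the type of the
   available variables of sort [s]. *)
Inductive term (L : language) (V : sorts L -> Type) : sorts L -> Type :=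
| Var s : V s -> term V s
| App (f : fsym L) : (forall i : 'I_(farity f), term V (fdom i)) ->
                     term V (fcod f).

Inductive ext (S : Type) (V : S -> Type) (s0 : S) : S -> Type :=
| Old s : V s -> ext V s0 s
| New : ext V s0 s0.

Inductive form (L : language) (V : sorts L -> Type) : Type :=
| Bot : form V
| Eq s : term V s -> term V s -> form V
| Rel (r : rsym L) : (forall i : 'I_(rarity r), term V (rdom i)) -> form V
| Imp : form V -> form V -> form V
| All s0 : form (ext V s0) -> form V.

Arguments Bot {L V}.

Definition Neg (L : language) (V : sorts L -> Type) (phi : form V) : form V :=
  Imp phi Bot.

Record structure (L : language) := Structure {
  carrier :> sorts L -> Type;
  carrier_inhabited : forall s, inhabited (carrier s);
  finterp : forall f : fsym L,
    (forall i : 'I_(farity f), carrier (fdom i)) -> carrier (fcod f);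
  rinterp : forall r : rsym L,
    (forall i : 'I_(rarity r), carrier (rdom i)) -> Prop }.

Definition env (S : Type) (V M : S -> Type) := forall s, V s -> M s.

Definition extend (S : Type) (V M : S -> Type) (s0 : S) (e : env V M)
    (a : M s0) : env (ext V s0) M :=
  fun s v => match v in ext _ _ s return M s with
             | Old _ w => e _ w
             | New => a
             end.

Fixpoint eval (L : language) (M : structure L) (V : sorts L -> Type)
    (e : env V M) (s : sorts L) (t : term V s) : M s :=
  match t in term _ s return M s with
  | Var _ v => e _ v
  | App f args => finterp (fun i => eval e (args i))
  end.

Fixpoint sat (L : language) (M : structure L) (V : sorts L -> Type)
    (e : env V M) (phi : form V) {struct phi} : Prop :=
  match phi with
  | Bot => False
  | Eq _ t u => eval e t = eval e u
  | Rel r args => rinterp (fun i => eval e (args i))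
  | Imp phi psi => sat e phi -> sat e psi
  | All s0 phi => forall a : M s0, sat (extend e a) phi
  end.

Definition novar (S : Type) : S -> Type := fun _ => void.

Definition novar_env (S : Type) (M : S -> Type) : env (@novar S) M :=
  fun s v => of_void (M s) v.

Definition sentence (L : language) := form (@novar (sorts L)).

Definition models (L : language) (M : structure L) (T : set (sentence L)) :=
  forall phi, T phi -> sat (@novar_env _ M) phi.

Definition entails (L : language) (T : set (sentence L)) (phi : sentence L) :=
  forall M : structure L, models M T -> sat (@novar_env _ M) phi.

Definition complete_theory (L : language) (T : set (sentence L)) :=
  (exists M : structure L, models M T) /\
  (forall phi, entails T phi \/ entails T (Neg phi)).

(** * Formulas with parameters, types, definable sets *)

Definition params (L : language) (M : structure L) := forall s, set (M s).

Definition allparams (L : language) (M : structure L) : params M :=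
  fun s => setT.

Definition param (L : language) (M : structure L) (B : params M)
  (s : sorts L) := {a : M s | B s a}.

Definition param_env (L : language) (M : structure L) (B : params M) :
    env (param B) M :=
  fun s b => sval b.

Definition join_env (S : Type) (V W M : S -> Type) (e : env V M)
    (f : env W M) : env (fun s => V s + W s)%type M :=
  fun s v => match v with inl x => e s x | inr y => f s y end.

(* L(B)-formulas: the constants naming the elements of [B] are variables which
   [psat] always interprets by the elements they name. *)
Definition pform (L : language) (M : structure L) (V : sorts L -> Type)
  (B : params M) := form (fun s => V s + param B s)%type.

Definition psat (L : language) (M : structure L) (V : sorts L -> Type)
    (B : params M) (e : env V M) (phi : pform V B) : Prop :=
  sat (join_env e (param_env (B := B))) phi.

(* The variables x_0, ..., x_(n-1), where x_i has sort [sigma i]. *)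
Inductive tvar (S : Type) (n : nat) (sigma : 'I_n -> S) : S -> Type :=
| TVar (i : 'I_n) : tvar sigma (sigma i).

Definition tup (L : language) (M : structure L) (n : nat)
  (sigma : 'I_n -> sorts L) := forall i, M (sigma i).

Definition tup_env (L : language) (M : structure L) (n : nat)
    (sigma : 'I_n -> sorts L) (x : tup M sigma) : env (tvar sigma) M :=
  fun s v => match v in tvar _ s return M s with TVar i => x i end.

Section Types.
Variables (L : language) (M : structure L) (n : nat) (sigma : 'I_n -> sorts L).

Definition definable (B : params M) (D : set (tup M sigma)) :=
  exists phi : pform (tvar sigma) B,
    forall x, D x <-> psat (tup_env x) phi.

Definition definable2 (B : params M) (D : set (tup M sigma * tup M sigma)) :=
  exists phi : pform (fun s => tvar sigma s + tvar sigma s)%type B,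
    forall x y, D (x, y) <-> psat (join_env (tup_env x) (tup_env y)) phi.

Definition finitely_satisfiable (B : params M)
    (p : set (pform (tvar sigma) B)) :=
  forall (k : nat) (phi : 'I_k -> pform (tvar sigma) B),
    (forall i, p (phi i)) ->
    exists x : tup M sigma, forall i, psat (tup_env x) (phi i).

(* p belongs to S_sigma(B) *)
Definition complete_type (B : params M) (p : set (pform (tvar sigma) B)) :=
  finitely_satisfiable p /\ (forall phi, p phi \/ p (Neg phi)).

Definition realizes (B : params M) (p : set (pform (tvar sigma) B))
    (x : tup M sigma) :=
  forall phi, p phi -> psat (tup_env x) phi.

End Types.

(** * Monster models *)

Definition card_lt (T U : Type) : Prop :=
  [set: T] #<= [set: U] /\ ~ ([set: U] #<= [set: T]).

(* The cardinal kappa is represented by a type [K] of that cardinality. *)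
Definition small (L : language) (M : structure L) (K : Type) (B : params M) :=
  card_lt {s : sorts L & param B s} K.

Definition saturated (L : language) (M : structure L) (K : Type) :=
  forall B : params M, small K B ->
  forall (n : nat) (sigma : 'I_n -> sorts L) (p : set (pform (tvar sigma) B)),
    complete_type p -> exists x : tup M sigma, realizes p x.

Record automorphism (L : language) (M : structure L)
    (g : forall s, M s -> M s) : Prop := Automorphism {
  aut_bij : forall s, bijective (g s);
  aut_fun : forall (f : fsym L) (x : forall i : 'I_(farity f), M (fdom i)),
    g _ (finterp x) = finterp (fun i => g _ (x i));
  aut_rel : forall (r : rsym L) (x : forall i : 'I_(rarity r), M (rdom i)),
    rinterp x <-> rinterp (fun i => g _ (x i)) }.

(* Partial elementary maps with small domain extend to automorphisms. *)
Definition strongly_homogeneous (L : language) (M : structure L) (K : Type) :=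
  forall B : params M, small K B ->
  forall f : env (param B) M,
    (forall phi : form (param B), sat (param_env (B := B)) phi <-> sat f phi) ->
  exists2 g : forall s, M s -> M s,
    automorphism g & forall s (b : param B s), g s (sval b) = f s b.

(* The first clause says that kappa is greater than |L| + aleph_0. *)
Record monster (L : language) (T : set (sentence L)) (M : structure L)
    (K : Type) : Prop := Monster {
  monster_card : card_lt (sorts L + fsym L + rsym L + nat) K;
  monster_models : models M T;
  monster_saturated : saturated M K;
  monster_homogeneous : strongly_homogeneous M K }.

(** * Orders and convex sets *)

Section Orders.
Variable X : Type.
Implicit Types (lt tri E : set (X * X)) (C D : set X).

Definition strict_linear_order lt :=
  [/\ forall x, ~ lt (x, x),
      forall x y z, lt (x, y) -> lt (y, z) -> lt (x, z) &
      forall x y, [\/ lt (x, y), x = y | lt (y, x)]].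

Definition equivalence_rel_on E :=
  [/\ forall x, E (x, x),
      forall x y, E (x, y) -> E (y, x) &
      forall x y z, E (x, y) -> E (y, z) -> E (x, z)].

Definition convex lt C :=
  forall x y z, C x -> C z -> lt (x, y) -> lt (y, z) -> C y.

(* maximal convex subsets of [D] *)
Definition convex_component lt D C :=
  [/\ C !=set0, C `<=` D, convex lt C &
      forall C', C' `<=` D -> convex lt C' -> C `<=` C' -> C' = C].

(* <_E *)
Definition reverse_in lt E : set (X * X) :=
  [set xy | E xy /\ lt (xy.2, xy.1) \/ ~ E xy /\ lt xy].

(* <_(E_0, ..., E_n) *)
Definition reverse_in_seq lt (Es : seq (set (X * X))) : set (X * X) :=
  foldl reverse_in lt Es.

Definition id_rel : set (X * X) := [set xy | xy.1 = xy.2].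

Definition strictly_increasing (Es : seq (set (X * X))) :=
  forall i j : nat, (i < j < size Es)%N ->
    nth set0 Es i `<` nth set0 Es j.

Definition right_eventual lt D :=
  exists F : set X,
    [/\ F !=set0, forall x y, F x -> lt (x, y) -> F y & F `<=` D].

Definition same_orientation lt tri :=
  exists a : X, right_eventual lt [set x | tri (a, x)].

End Orders.

(** * Weakly o-minimal pairs *)

Section WeaklyOMinimal.
Variables (L : language) (M : structure L) (A : params M).
Variables (n : nat) (sigma : 'I_n -> sorts L) (p : set (pform (tvar sigma) A)).

(* p(M) *)
Definition locus := {x : tup M sigma | realizes p x}.

Definition rel_definable (B : params M) (D : set locus) :=
  exists2 D' : set (tup M sigma),
    definable B D' & forall x, D x <-> D' (sval x).

Definition rel_definable2 (B : params M) (R : set (locus * locus)) :=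
  exists2 R' : set (tup M sigma * tup M sigma),
    definable2 B R' & forall x y, R (x, y) <-> R' (sval x, sval y).

Definition weakly_o_minimal_pair (lt : set (locus * locus)) :=
  [/\ complete_type p, strict_linear_order lt, rel_definable2 A lt &
      forall D : set locus, rel_definable (@allparams L M) D ->
        finite_set [set C | convex_component lt D C]].

(* E_p *)
Definition definable_equivalences : set (set (locus * locus)) :=
  [set E | equivalence_rel_on E /\ rel_definable2 A E].

End WeaklyOMinimal.

(* Main.v *)
Require Import Defs.
From mathcomp Require Import all_boot.
From mathcomp Require Import boolp classical_sets functions cardinality filter.

Set Implicit Arguments.
Unset Strict Implicit.
Unset Printing Implicit Defensive.

(**
Automorphisms over [A] act transitively on the locus of [p], preserving [<] and
[tri]; every definable section of [tri] has finitely many convex components, so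
chains along which it alternates have bounded length.

Consider a pair [a < b], the least invariant convex equivalence relation [V]
containing it and the largest one [W] below [V].  The key point is that [<] and
[tri] agree either on all pairs of [V \ W] or on none.  Near both ends of a
[V]-class the sign must be the same, say positive.  If some pair of [V \ W] were
inverted, let [upset c] be the tri-final segment generated by the elements lying
above [c] at the scale of [V \ W].  If all these sets are [<]-final, lying in the
same ones is an invariant convex equivalence relation containing an inverted pair, hence [V],
whereas these sets do separate points.  Otherwise a maximal alternating chain for
some [upset c] can be prolonged, unless [V / W] is discrete, in which case iterating
an automorphism along an inverted pair contradicts positivity at the right end.

Hence the number of further sign changes beyond [y], seen from [x], depends only on
the invariant convex equivalence relation generated by [(x, y)], and its superlevel
sets are the relations [E_i].  They are definable over [A] by compactness: both a
superlevel set and its complement are witnessed by alternating chains of fixed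
length.  Conversely any representation is recovered from these numbers.
*)

(** * Strict linear orders as boolean relations *)

Record linear (X : Type) (r : rel X) : Prop := Linear {
  lin_irr : forall x, ~~ r x x;
  lin_trans : forall y x z, r x y -> r y z -> r x z;
  lin_total : forall x y, [\/ r x y, x = y | r y x] }.

Section LinearOrder.
Variables (X : Type) (lt : rel X).
Hypothesis ltL : linear lt.

Lemma lin_asym x y : lt x y -> ~~ lt y x.
Proof.
by move=> xy; apply/negP => /(lin_trans ltL xy) /(negP (lin_irr ltL x)).
Qed.

Lemma lin_le x y : ~~ lt y x -> x = y \/ lt x y.
Proof. by move=> h; case: (lin_total ltL x y) h => [||->//]; auto. Qed.

Lemma lin_lt_le_trans y x z : lt x y -> ~~ lt z y -> lt x z.
Proof. by move=> xy /lin_le[<-//|]; apply: (lin_trans ltL xy). Qed.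

Lemma lin_le_lt_trans y x z : ~~ lt y x -> lt y z -> lt x z.
Proof. by move=> /lin_le[<-//|xy]; apply: (lin_trans ltL xy). Qed.

Lemma lin_le_trans y x z : ~~ lt y x -> ~~ lt z y -> ~~ lt z x.
Proof. by move=> xy yz; apply/negP => zx; move: (lin_lt_le_trans zx xy); apply/negP. Qed.

Lemma lin_neg x y : x <> y -> lt y x = ~~ lt x y.
Proof.
move=> ne; case: (lin_total ltL x y) => // xy.
- by rewrite xy (negbTE (lin_asym xy)).
- by rewrite (negbTE (lin_asym xy)).
Qed.

End LinearOrder.

Lemma linear_converse (X : Type) (r : rel X) :
  linear r -> linear (fun x y => r y x).
Proof.
move=> rL; split=> [x|y x z /= yx zy|x y]; first exact: lin_irr rL x.
- by apply: (lin_trans rL zy).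
- by case: (lin_total rL x y); [constructor 3|constructor 2|constructor 1].
Qed.

(** * Alternating chains *)

Section Chains.
Variables (X : Type) (lt : rel X).

(** Chains are total sequences of which only the first [k] values count, so prepending and
    truncating need no casts. *)
Definition chain (P : pred X) (b : bool) (k : nat) (u : nat -> X) : Prop :=
  (forall i, i < k -> P (u i) = b (+) odd i) /\
  (forall i, i.+1 < k -> lt (u i) (u i.+1)).

Definition bounded_chains (P : pred X) (N : nat) : Prop :=
  forall b k u, chain P b k u -> k <= N.

Definition ucons (x : X) (u : nat -> X) (i : nat) : X :=
  if i is i'.+1 then u i' else x.

Definition urcons (u : nat -> X) (k : nat) (x : X) (i : nat) : X :=
  if i < k then u i else x.

Lemma chain_cons P b k u x : chain P b k u -> P x = ~~ b ->
  (0 < k -> lt x (u 0)) -> chain P (~~ b) k.+1 (ucons x u).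
Proof.
move=> [h1 h2] Px xu; split=> [[|i] //= ik|[|i] //= ik].
- by rewrite Px addbF.
- by rewrite h1 // addNb addbN negbK.
- exact: (h2 _ ik).
Qed.

Lemma chain_rcons P b k u x : chain P b k u -> P x = b (+) odd k ->
  (0 < k -> lt (u k.-1) x) -> chain P b k.+1 (urcons u k x).
Proof.
move=> [h1 h2] Px ux; split=> i; rewrite /urcons ltnS.
- by rewrite leq_eqVlt => /orP[/eqP->|ik]; rewrite ?ltnn // ik h1.
- move=> ik; rewrite ik; move: ik; rewrite leq_eqVlt => /orP[/eqP e|ik].
    by rewrite -e ltnn; have := ux; rewrite -e => ->.
  by rewrite ik h2.
Qed.

Lemma chain_tail P b k u : chain P b k.+1 u ->
  chain P (~~ b) k (fun i => u i.+1).
Proof.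
move=> [h1 h2]; split=> i ik; first by rewrite h1 //= addNb addbN.
exact: h2.
Qed.

Lemma chain_take P b k m u : chain P b k u -> m <= k -> chain P b m u.
Proof.
move=> [h1 h2] mk; split=> i im; first by apply: h1; apply: leq_trans mk.
by apply: h2; apply: leq_trans mk.
Qed.

Hypothesis ltL : linear lt.

Lemma chain_lt P b k u i j : chain P b k u -> i < j -> j < k -> lt (u i) (u j).
Proof.
move=> [_ h2]; elim: j => // j IH; rewrite ltnS leq_eqVlt => /orP[/eqP->|ij] jk.
  exact: h2.
by apply: lin_trans (h2 _ jk) => //; apply: IH => //; apply: ltnW.
Qed.

Lemma chain_head_le P b k u i : chain P b k u -> i < k -> ~~ lt (u i) (u 0).
Proof.
case: i => [|i] c ik; first exact: lin_irr.
by apply: lin_asym => //; apply: chain_lt c _ ik.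
Qed.

Lemma max_nat (Q : nat -> Prop) N : (exists k, Q k) ->
  (forall k, Q k -> k <= N) -> exists2 k, Q k & forall m, Q m -> m <= k.
Proof.
move=> [k0 Qk0] QN.
have ex : exists k, `[< Q k >] by exists k0; apply/asboolP.
have ub k : `[< Q k >] -> k <= N by move=> /asboolP; apply: QN.
case: (ex_maxnP ex ub) => k /asboolP Qk kmax; exists k => // m Qm.
by apply: kmax; apply/asboolP.
Qed.

End Chains.

(** * Convex equivalence relations invariant under a transitive family of order-preserving maps *)

Section Invariant.
Variables (X : Type) (lt : rel X) (G : (X -> X) -> Prop).

Record ice (E : X -> X -> Prop) : Prop := Ice {
  ice_inv : forall g x y, G g -> (E x y <-> E (g x) (g y));
  ice_refl : forall x, E x x;
  ice_sym : forall x y, E x y -> E y x;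
  ice_trans : forall y x z, E x y -> E y z -> E x z;
  ice_convex : forall x y z, lt x y -> lt y z -> E x z -> E x y }.

Definition gen a b x y := forall E, ice E -> E a b -> E x y.

Definition below a b x y := exists E, [/\ ice E, E x y & ~ E a b].

(* [x < y], far apart at the scale of the pair [(a, b)] *)
Definition ll a b x y := [/\ lt x y, gen a b x y & ~ below a b x y].

Hypothesis ltL : linear lt.
Hypothesis Gsurj : forall g, G g -> forall y, exists x, g x = y.
Hypothesis Glt : forall g, G g -> forall x y, lt (g x) (g y) = lt x y.
Hypothesis Gtrans : forall a b, exists2 g, G g & g a = b.

Lemma ice_invE E g x y : ice E -> G g -> E (g x) (g y) = E x y.
Proof. by move=> iE Gg; apply/propext; split=> /(ice_inv iE x y Gg). Qed.

Lemma ice_betweenl E x y z : ice E -> E x z -> ~~ lt y x -> ~~ lt z y -> E x y.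
Proof.
move=> iE xz /(lin_le ltL)[<- _|xy]; first exact: ice_refl.
move=> /(lin_le ltL)[->//|yz]; exact: (ice_convex iE xy yz xz).
Qed.

Lemma ice_betweenr E x y z : ice E -> E x z -> ~~ lt y x -> ~~ lt z y -> E y z.
Proof.
move=> iE xz xy yz; have yx := ice_sym iE (ice_betweenl iE xz xy yz).
exact: (ice_trans iE yx xz).
Qed.

(** Given increasing pairs [(a, b)] in [E] only and [(c, d)] in [E'] only, a map in [G] moves [c] to
    [a]; by convexity, whichever right endpoint then comes first is related to [a] by both
    relations. *)
Lemma ice_comparable E E' : ice E -> ice E' ->
  (forall x y, E x y -> E' x y) \/ (forall x y, E' x y -> E x y).
Proof.
move=> iE iE'; apply: contrapT => /not_orP[/existsNP[a /existsNP[b /not_implyP[Eab nEab]]]].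
move=> /existsNP[c /existsNP[d /not_implyP[Ecd nEcd]]].
wlog ab : a b Eab nEab / lt a b.
  move=> H; case: (lin_total ltL a b) => [|e|ba]; first exact: H Eab nEab.
    by apply: nEab; rewrite e; apply: ice_refl.
  by apply: (H b a) => //; [exact: ice_sym|move=> /(ice_sym iE')].
wlog cd : c d Ecd nEcd / lt c d.
  move=> H; case: (lin_total ltL c d) => [|e|dc]; first exact: H Ecd nEcd.
    by apply: nEcd; rewrite e; apply: ice_refl.
  by apply: (H d c) => //; [exact: ice_sym|move=> /(ice_sym iE)].
have [g Gg gca] := Gtrans c a.
move: Ecd nEcd cd; rewrite (ice_inv iE' c d Gg) (ice_inv iE c d Gg) -(Glt Gg) gca.
move: (g d) => {g Gg gca c}d Ead nEad ad.
case: (boolP (lt d b)) => [db|bd].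
  exact: nEad (ice_convex iE ad db Eab).
exact: nEab (ice_betweenl iE' Ead (lin_asym ltL ab) bd).
Qed.

Lemma gen_ice a b : ice (gen a b).
Proof.
split.
- move=> g x y Gg; split=> h E iE Eab; first by apply/(ice_inv iE x y Gg); apply: h.
  by apply/(ice_inv iE x y Gg); apply: h.
- by move=> x E iE _; apply: ice_refl.
- by move=> x y h E iE Eab; apply: (ice_sym iE); apply: h.
- by move=> y x z h1 h2 E iE Eab; apply: (ice_trans iE (h1 E iE Eab) (h2 E iE Eab)).
- by move=> x y z xy yz h E iE Eab; apply: (ice_convex iE xy yz (h E iE Eab)).
Qed.

Lemma gen_self a b : gen a b a b.
Proof. by move=> E. Qed.

(** * The cell [V \ W] of a pair, and the sign of [tri] near its two ends *)

Section Cell.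
Variables (a b : X).
Hypothesis (ab : lt a b).
Local Notation V := (gen a b).
Local Notation W := (below a b).
Local Notation "x <<< y" := (ll a b x y) (at level 70).

(** A union of invariant convex equivalence relations is transitive because they are pairwise
    comparable; reflexivity comes from the identity, which omits [(a, b)] as [a < b]. *)
Lemma below_ice : ice W.
Proof.
split.
- move=> g x y Gg; split=> -[E [iE Exy nE]]; exists E; split=> //.
    by rewrite (ice_invE _ _ iE Gg).
  by rewrite -(ice_invE _ _ iE Gg).
- move=> x; exists (fun x y => x = y); split=> //; last first.
    by move=> e; move: ab; rewrite e (negbTE (lin_irr ltL b)).
  split=> // [g u v Gg|y u v ->//|u v w uv vw e].
    split=> [->//|e]; case: (lin_total ltL u v) => //; rewrite -(Glt Gg) e.
      by rewrite (negbTE (lin_irr ltL _)).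
    by rewrite (negbTE (lin_irr ltL _)).
  by move: (lin_trans ltL uv vw); rewrite e (negbTE (lin_irr ltL _)).
- by move=> x y [E [iE Exy nE]]; exists E; split=> //; apply: (ice_sym iE).
- move=> y x z [E [iE Exy nE]] [E' [iE' Eyz nE']].
  case: (ice_comparable iE iE') => h.
    by exists E'; split=> //; apply: (ice_trans iE' (h _ _ Exy) Eyz).
  by exists E; split=> //; apply: (ice_trans iE Exy (h _ _ Eyz)).
- move=> x y z xy yz [E [iE Exy nE]]; exists E; split=> //.
  exact: (ice_convex iE xy yz Exy).
Qed.

Let iV : ice V := gen_ice a b.
Let iW : ice W := below_ice.

(** Later proofs build an auxiliary relation and use this to rule out one or both alternatives. *)
Lemma cell_dichotomy E : ice E ->
  (forall x y, V x y -> E x y) \/ (forall x y, E x y -> W x y).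
Proof.
move=> iE; case: (pselect (E a b)) => Eab; last by right=> x y Exy; exists E.
by left=> x y; apply.
Qed.

Lemma ll_lt x y : x <<< y -> lt x y. Proof. by case. Qed.
Lemma ll_V x y : x <<< y -> V x y. Proof. by case. Qed.

Lemma ll_inv g x y : G g -> (g x <<< g y) = (x <<< y).
Proof.
move=> Gg; rewrite /ll (Glt Gg) (ice_invE _ _ iV Gg).
by rewrite (_ : W (g x) (g y) = W x y) ?(ice_invE _ _ iW Gg).
Qed.

Lemma ll_le x y z : x <<< y -> ~~ lt z y -> V x z -> x <<< z.
Proof.
move=> [xy Vxy nW] yz Vxz; split=> //; first exact: (lin_lt_le_trans ltL xy yz).
move=> Wxz; apply: nW; apply: (ice_betweenl iW Wxz _ yz).
exact: (lin_asym ltL).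
Qed.

Lemma le_ll x y z : x <<< z -> ~~ lt x y -> V y z -> y <<< z.
Proof.
move=> [xz Vxz nW] yx Vyz; split=> //; first exact: (lin_le_lt_trans ltL yx xz).
move=> Wyz; apply: nW; apply: (ice_betweenr iW Wyz yx _).
exact: (lin_asym ltL).
Qed.

Lemma ll_trans y x z : x <<< y -> y <<< z -> x <<< z.
Proof.
move=> xy yz; apply: (ll_le xy (lin_asym ltL (ll_lt yz)) _).
exact: (ice_trans iV (ll_V xy) (ll_V yz)).
Qed.

Lemma ll_ab : a <<< b.
Proof. by split=> // -[E []]. Qed.

Lemma ll_right x : exists y, x <<< y.
Proof. by have [g Gg <-] := Gtrans a x; exists (g b); rewrite (ll_inv _ _ Gg); apply: ll_ab. Qed.

Variable tri : rel X.
Hypothesis triL : linear tri.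
Hypothesis Gtri : forall g, G g -> forall x y, tri (g x) (g y) = tri x y.
Hypothesis tri_chains : exists N, forall m, bounded_chains lt (tri m) N.

(** Take an alternating chain of maximal length for [tri a] among the points [ll]-above [a]: no sign
    change follows its last point inside the class. The maps in [G] carry this to every [x] with the
    same [e]. *)
Lemma sign_right : exists e, forall x, exists2 y, x <<< y &
  forall z, ~~ lt z y -> V x z -> tri x z = e.
Proof.
have [N HN] := tri_chains.
pose Q k := exists c u, chain lt (tri a) c k u /\ (forall i, i < k -> a <<< u i).
have [] := @max_nat Q N.
- exists 1, (tri a b), (fun=> b); split; last by move=> i _; apply: ll_ab.
  by split=> -[|i] //; rewrite /= addbF.
- by move=> k [c [u [cu _]]]; apply: HN cu.
case=> [|k] [c [u [cu au]]] kmax.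
  suff /kmax : Q 1 by [].
  exists (tri a b), (fun=> b); split; last by move=> i _; apply: ll_ab.
  by split=> -[|i] //; rewrite /= addbF.
exists (tri a (u k)) => x; have [g Gg <-] := Gtrans a x.
exists (g (u k)); first by rewrite (ll_inv _ _ Gg); apply: au.
move=> z; have [z' <-] := Gsurj Gg z; rewrite (Glt Gg) (Gtri Gg) => ukz.
rewrite (ice_invE _ _ iV Gg) => Vaz; apply: contrapT => ne.
suff /kmax : Q k.+2 by rewrite ltnn.
exists c, (urcons u k.+1 z'); split.
  apply: chain_rcons => //.
    have := cu.1 k (ltnSn k) => e; move: ne; rewrite e /=.
    by case: (tri a z'); case: c {cu e} => //=; case: (odd k).
  move=> _ /=; have [e|//] := lin_le ltL ukz.
  by case: ne; rewrite e.
move=> i; rewrite /urcons; case: (ltnP i k.+1) => [ik _|_ _]; first exact: au.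
exact: (ll_le (au k (ltnSn k)) ukz Vaz).
Qed.

Lemma sign_left : exists d, forall x, exists2 y, y <<< x &
  forall z, ~~ lt y z -> V z x -> tri z x = d.
Proof.
have [N HN] := tri_chains.
(* The bound concerns the sections [tri m], so [tri z b] is read as the negation of [tri b z]. *)
have neg z : z <<< b -> tri z b = ~~ tri b z.
  move=> /ll_lt zb; apply: lin_neg => // e.
  by move: zb; rewrite e (negbTE (lin_irr ltL _)).
pose Q k := exists c u, chain lt (tri b) c k u /\ (forall i, i < k -> u i <<< b).
have Q1 : Q 1.
  exists (tri b a), (fun=> a); split; last by move=> i _; apply: ll_ab.
  by split=> -[|i] //; rewrite /= addbF.
have [] := @max_nat Q N.
- by exists 1.
- by move=> k [c [u [cu _]]]; apply: HN cu.
case=> [|k] [c [u [cu au]]] kmax; first by move: (kmax _ Q1).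
exists (tri (u 0) b) => x; have [g Gg <-] := Gtrans b x.
exists (g (u 0)); first by rewrite (ll_inv _ _ Gg); apply: au.
move=> z; have [z' <-] := Gsurj Gg z; rewrite (Glt Gg) (Gtri Gg) => zu.
rewrite (ice_invE _ _ iV Gg) => Vzb; have zb : z' <<< b by by apply: (le_ll _ zu Vzb); apply: au.
rewrite (neg _ zb) (neg (u 0)); last exact: au.
congr (~~ _).
apply: contrapT => ne.
suff /kmax : Q k.+2 by rewrite ltnn.
exists (~~ c), (ucons z' u); split.
  apply: chain_cons => //.
    have := cu.1 0 isT => e; move: ne; rewrite e /= addbF.
    by case: (tri b z'); case: c {cu e}.
  by move=> _; have [e|//] := lin_le ltL zu; case: ne; rewrite e.
by case=> [|i] //= ik; apply: au.
Qed.

(* The cut below which [x'] sees the sign [d] can be moved above any [x]. *)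
Lemma sign_right_left e d :
  (forall x, exists2 y, x <<< y & forall z, ~~ lt z y -> V x z -> tri x z = e) ->
  (forall x, exists2 y, y <<< x & forall z, ~~ lt y z -> V z x -> tri z x = d) ->
  e = d.
Proof.
move=> hr hl; have [y ay hy] := hr a; have [y' ya hy'] := hl a.
have [g Gg gy] := Gtrans y' y.
have yx : y <<< g a by rewrite -gy; rewrite (ll_inv _ _ Gg).
have Vx : V a (g a) := ice_trans iV (ll_V ay) (ll_V yx).
rewrite -(hy (g a)) //; last exact: (lin_asym ltL (ll_lt yx)).
have [a' ga'] := Gsurj Gg a; rewrite -{1}ga' (Gtri Gg); apply: hy'.
  by rewrite -(Glt Gg) ga' gy; apply: (lin_asym ltL (ll_lt ay)).
by rewrite -(ice_invE _ _ iV Gg) ga'.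
Qed.

(** * Cells that are positive near both ends *)

Hypothesis right_pos : forall x, exists2 y, x <<< y &
  forall z, ~~ lt z y -> V x z -> tri x z.
Hypothesis left_pos : forall x, exists2 y, y <<< x &
  forall z, ~~ lt y z -> V z x -> tri z x.

Let llt x y (h : x <<< y) : lt x y := ll_lt h.
Let llV x y (h : x <<< y) : V x y := ll_V h.

Definition upset c w : Prop := exists2 z, c <<< z & tri z w.

Lemma upset_inv g c w : G g -> upset (g c) (g w) = upset c w.
Proof.
move=> Gg; apply/propext; split=> -[z cz zw].
  have [z' e] := Gsurj Gg z; exists z'.
    by rewrite -e (ll_inv _ _ Gg) in cz.
  by rewrite -e (Gtri Gg) in zw.
by exists (g z); rewrite ?(ll_inv _ _ Gg) ?(Gtri Gg).
Qed.

Lemma upset_tri c w w' : upset c w -> tri w w' -> upset c w'.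
Proof. by move=> [z cz zw] ww'; exists z => //; apply: (lin_trans triL zw). Qed.

Lemma upset_anti c c' w : ~~ lt c' c -> V c c' -> upset c' w -> upset c w.
Proof.
move=> cc' Vcc' [z cz zw]; exists z => //; apply: (le_ll cz cc').
exact: (ice_trans iV Vcc' (llV cz)).
Qed.

Lemma upset_nonempty c : exists2 w, upset c w & V c w.
Proof.
have [z cz] := ll_right c.
have [w zw h] := right_pos z; exists w.
  by exists z => //; apply: h (llV zw); apply: (lin_irr ltL).
exact: (ice_trans iV (llV cz) (llV zw)).
Qed.

(* Some [u] is tri-above every [w <= x]; beyond [u] everything is tri-above [u]. *)
Lemma upset_avoid x : exists2 c, V x c & forall w, ~~ lt x w -> V x w -> ~ upset c w.
Proof.
have [u Vxu hu] : exists2 u, V x u & forall w, ~~ lt x w -> V x w -> tri w u.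
  have [y ya hy] := left_pos a; have [g Gg <-] := Gtrans y x.
  exists (g a); first by rewrite (ice_invE _ _ iV Gg); apply: llV.
  move=> w; have [w' <-] := Gsurj Gg w; rewrite (Glt Gg) (Gtri Gg) => yw'.
  rewrite (ice_invE _ _ iV Gg) => Vyw; apply: hy => //.
  exact: (ice_trans iV (ice_sym iV Vyw) (llV ya)).
have [c uc hc] := right_pos u; exists c; first exact: (ice_trans iV Vxu (llV uc)).
move=> w xw Vxw [z cz zw].
have : tri u z.
  by apply: hc (ice_trans iV (llV uc) (llV cz)); apply: (lin_asym ltL (llt cz)).
by rewrite (negbTE (lin_asym triL (lin_trans triL zw (hu _ xw Vxw)))).
Qed.

(** The finitely many chain points lying in [upset c] have finitely many witnesses; for the
    [tri]-least witness [m] the chain alternates for [tri m] as well. *)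
Lemma upset_chains : exists N, forall c, bounded_chains lt (fun w => `[< upset c w >]) N.
Proof.
have [N HN] := tri_chains; exists N => c d k u [h1 h2].
have [m cm mT] : exists2 m, c <<< m & forall i, i < k -> upset c (u i) -> tri m (u i).
  elim: (k) => [|j [m cm IH]].
    by have [m cm] := ll_right c; exists m.
  case: (pselect (upset c (u j))) => [[m' cm' m'u]|nT]; last first.
    by exists m => // i; rewrite ltnS leq_eqVlt => /orP[/eqP->//|]; apply: IH.
  case: (boolP (tri m' m)) => mm'.
    exists m' => // i; rewrite ltnS leq_eqVlt => /orP[/eqP->//|ij /(IH _ ij)].
    exact: (lin_trans triL mm').
  exists m => // i; rewrite ltnS leq_eqVlt => /orP[/eqP-> _|]; last exact: IH.
  exact: (lin_le_lt_trans triL mm').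
apply: (HN m d k u); split=> // i ik; rewrite -h1 //.
by apply/idP/asboolP => [mu|/mT]; [exists m|apply].
Qed.

(* If all the [upset c] were final segments then "being in the same [upset c]" would be
   an invariant convex equivalence relation containing every inversion. *)
Lemma upset_not_final x z : x <<< z -> tri z x ->
  exists c w w', [/\ upset c w, lt w w', ~ upset c w', V c w & V c w'].
Proof.
move=> xz zx; apply: contrapT => nex.
have final c w w' : upset c w -> lt w w' -> V c w -> V c w' -> upset c w'.
  by move=> Tw ww' ? ?; apply: contrapT => nT; apply: nex; exists c, w, w'.
pose A u v := V u v /\ forall c, V c u -> (upset c u <-> upset c v).
have iA : ice A.
  split.
  - move=> g u v Gg; rewrite /A (ice_invE _ _ iV Gg).
    split=> -[Vuv h]; split=> // c.
      have [c' <-] := Gsurj Gg c; rewrite !upset_inv // (ice_invE _ _ iV Gg); exact: h.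
    by rewrite -(upset_inv c u Gg) -(upset_inv c v Gg) -(ice_invE _ _ iV Gg); apply: h.
  - by move=> u; split=> //; exact: (ice_refl iV).
  - move=> u v [Vuv h]; split=> [|c Vcv]; first exact: (ice_sym iV).
    by rewrite h //; exact: (ice_trans iV Vcv (ice_sym iV Vuv)).
  - move=> v u w [Vuv h] [Vvw h']; split=> [|c Vcu]; first exact: (ice_trans iV Vuv Vvw).
    by rewrite h // h' //; exact: (ice_trans iV Vcu Vuv).
  - move=> u v w uv vw [Vuw h]; have Vuv := ice_convex iV uv vw Vuw.
    split=> // c Vcu; have Vcv := ice_trans iV Vcu Vuv.
    have Vcw := ice_trans iV Vcu Vuw.
    by split=> [/final|/final/(_ vw Vcv Vcw)/(h _ Vcu)//]; apply.
(* [A] does not contain [V], since some [upset c'] misses [w] but meets its class. Nor does it lie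
   in [W]: by finality and [tri z x], the points [x] and [z] belong to the same sets. *)
case: (cell_dichotomy iA) => [VA|AW].
  have [w Tw Vxw] := upset_nonempty x.
  have [c' Vwc' nT] := upset_avoid w.
  have [w' Tw' Vcw'] := upset_nonempty c'.
  have [_ h] := VA w w' (ice_trans iV Vwc' Vcw').
  apply: (nT w); [exact: (lin_irr ltL)|exact: (ice_refl iV)|].
  by apply/h => //; exact: (ice_sym iV).
case: (xz) => _ Vxz; apply; apply: AW; split=> // c Vcx; split=> [h|/upset_tri/(_ zx)//].
exact: (final _ _ _ h (llt xz) Vcx (ice_trans iV Vcx Vxz)).
Qed.

(** The avoided points form a lower cut, standing for an infimum that need not exist. *)
Definition avoids c x := forall w, ~~ lt x w -> V x w -> ~ upset c w.

Lemma avoids_inv g c x : G g -> avoids (g c) (g x) = avoids c x.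
Proof.
move=> Gg; apply/propext; split=> h w xw Vxw.
  by rewrite -(upset_inv c w Gg); apply: h; rewrite ?(Glt Gg) ?(ice_invE _ _ iV Gg).
move: xw Vxw; have [w' <-] := Gsurj Gg w.
by rewrite (Glt Gg) (ice_invE _ _ iV Gg) (upset_inv _ _ Gg); apply: h.
Qed.

Lemma avoids_mono c c' x : ~~ lt c' c -> V c c' -> avoids c x -> avoids c' x.
Proof. by move=> cc' Vcc' h w xw Vxw /(upset_anti cc' Vcc'); apply: h. Qed.

(* The infimum of [upset c] is a weakly increasing function of [c], strictly so on
   the scale of the cell. *)
Lemma avoids_strict c d : c <<< d -> exists2 x, V c x & upset c x /\ avoids d x.
Proof.
move=> cd; apply: contrapT => nex.
pose H c c' := V c c' /\ forall x, V c x -> (avoids c x <-> avoids c' x).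
have iH : ice H.
  split.
  - move=> g u v Gg; rewrite /H (ice_invE _ _ iV Gg).
    split=> -[Vuv h]; split=> // x.
      have [x' <-] := Gsurj Gg x; rewrite !avoids_inv // (ice_invE _ _ iV Gg); exact: h.
    by rewrite -(avoids_inv u x Gg) -(avoids_inv v x Gg) -(ice_invE _ _ iV Gg); apply: h.
  - by move=> u; split=> //; exact: (ice_refl iV).
  - move=> u v [Vuv h]; split=> [|x Vvx]; first exact: (ice_sym iV).
    by rewrite h //; exact: (ice_trans iV Vuv Vvx).
  - move=> v u w [Vuv h] [Vvw h']; split=> [|x Vux]; first exact: (ice_trans iV Vuv Vvw).
    by rewrite h // h' //; exact: (ice_trans iV (ice_sym iV Vuv) Vux).
  - move=> u v w uv vw [Vuw h]; have Vuv := ice_convex iV uv vw Vuw.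
    split=> // x Vux; split; first exact: (avoids_mono (lin_asym ltL uv)).
    move=> /(avoids_mono (lin_asym ltL vw) (ice_trans iV (ice_sym iV Vuv) Vuw)).
    by move=> /(h _ Vux).
(* If [V] were inside [H], some [c'] avoiding an element of [upset c] would have the same cut as
   [c]. Otherwise the assumed absence of [x] puts [(c, d)] in [H], hence in [W]. *)
case: (cell_dichotomy iH) => [VH|HW].
  have [w Tw Vcw] := upset_nonempty c; have [c' Vwc' cl] := upset_avoid w.
  have [_ h] := VH c c' (ice_trans iV Vcw Vwc').
  by apply: (proj2 (h w Vcw) cl w) => //; [exact: (lin_irr ltL)|exact: (ice_refl iV)].
case: (cd) => cd' Vcd; apply; apply: HW; split=> // x Vcx; split.
  exact: (avoids_mono (lin_asym ltL cd')).
move=> cl w xw Vxw Tw; apply: nex; exists w; first exact: (ice_trans iV Vcx Vxw).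
split=> // w' ww' Vww'; apply: cl; first exact: (lin_le_trans ltL ww' xw).
exact: (ice_trans iV Vxw Vww').
Qed.

(* A chain of maximal length for some [upset c] is still a chain for every [upset c'] with
   [c'] slightly above [c]; two more alternations are found below it. *)
Lemma not_dense x z : x <<< z -> tri z x ->
  ~ (forall c d, c <<< d -> exists2 e, c <<< e & e <<< d).
Proof.
move=> xz zx dense.
have descent u : exists c w, [/\ lt w u, upset c w, ~ upset c u, V u c & V u w].
  have [c [w [u' [Tw wu' nT Vcw Vcu]]]] := upset_not_final xz zx.
  have [g Gg <-] := Gtrans u' u; exists (g c), (g w).
  rewrite (Glt Gg) !(upset_inv _ _ Gg) !(ice_invE _ _ iV Gg); split=> //.
    exact: (ice_sym iV).
  exact: (ice_trans iV (ice_sym iV Vcu) Vcw).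
have [N HN] := upset_chains.
pose Q k := exists c u, chain lt (fun w => `[< upset c w >]) true k u /\
  forall i, i < k -> V c (u i).
have [] := @max_nat Q N.
- by exists 0, a, (fun=> a).
- by move=> k [c [u [cu _]]]; apply: HN cu.
move=> [|k] [c [u [cu Vu]]] kmax.
  have [w Tw Vaw] := upset_nonempty a.
  suff /kmax : Q 1 by [].
  exists a, (fun=> w); split=> //; split=> -[|i] // _.
  by rewrite addbF; apply/asboolP.
(* Density lets [d] stay [ll]-below the witnesses that place chain points in [upset c], so these
   points remain in [upset d]. *)
have [d cd dT] : exists2 d, c <<< d & forall i, i < k.+1 -> upset c (u i) -> upset d (u i).
  elim: (k.+1) => [|j [d cd IH]]; first by have [d cd] := ll_right c; exists d.
  case: (pselect (upset c (u j))) => [[m cm mu]|nT]; last first.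
    by exists d => // i; rewrite ltnS leq_eqVlt => /orP[/eqP->//|]; apply: IH.
  have [e ce em] := dense _ _ cm; have Te : upset e (u j) by exists m.
  have Vde : V d e := ice_trans iV (ice_sym iV (llV cd)) (llV ce).
  case: (boolP (lt e d)) => ed.
    exists e => // i; rewrite ltnS leq_eqVlt => /orP[/eqP->//|ij /(IH _ ij)].
    exact: (upset_anti (lin_asym ltL ed) (ice_sym iV Vde)).
  exists d => // i; rewrite ltnS leq_eqVlt => /orP[/eqP-> _|]; last exact: IH.
  exact: (upset_anti ed Vde).
(* With [y] in [upset c] but below [upset d], and [w < y] where [upset c'] contains [w] and misses
   [y], antitonicity of [upset] forces [c < c' < d]. *)
have [y Vcy [Ty cl]] := avoids_strict cd.
have [c' [w [wy Tw nTy Vyc' Vyw]]] := descent y.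
have Vcc' : V c c' := ice_trans iV Vcy Vyc'.
have Vcd := llV cd.
have cc' : lt c c'.
  apply: contrapT => /negP /upset_anti h; apply: nTy; apply: h Ty.
  exact: (ice_sym iV).
have c'd : lt c' d.
  apply: contrapT => /negP /upset_anti h; apply: (cl w) => //; first exact: (lin_asym ltL).
  by apply: h Tw; exact: (ice_trans iV (ice_sym iV Vcd) Vcc').
have Tu i : i < k.+1 -> upset c' (u i) <-> upset c (u i).
  move=> ik; split; first exact: (upset_anti (lin_asym ltL cc') Vcc').
  move=> /(dT _ ik); apply: (upset_anti (lin_asym ltL c'd)).
  exact: (ice_trans iV (ice_sym iV Vcc') Vcd).
(* Prepending [w] (inside) and [y] (outside) to the [k.+1] points lengthens the chain by two and
   keeps its initial sign. *)
suff /kmax : Q k.+3 by rewrite ltnS ltnNge leqnSn.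
exists c', (ucons w (ucons y u)); split.
  apply: (@chain_cons _ _ _ false) => //; last by apply/asboolP.
  apply: (@chain_cons _ _ _ true); last 1 first.
  - move=> _; apply: contrapT => /negP yu; apply: (cl (u 0)) => //.
      exact: (ice_trans iV (ice_sym iV Vcy) (Vu 0 isT)).
    by apply: dT => //; apply/asboolP; rewrite (cu.1 0 isT).
  - split; last exact: cu.2.
    by move=> i ik; rewrite -(cu.1 i ik); apply/asboolP/asboolP => /(Tu _ ik).
  - by apply/asboolPn.
have Vc'c := ice_sym iV Vcc'.
case=> [|[|i]] /= ik.
- exact: (ice_trans iV (ice_sym iV Vyc') Vyw).
- exact: (ice_sym iV).
- exact: (ice_trans iV Vc'c (Vu _ ik)).
Qed.

Definition between u v w :=
  (~~ lt w u && ~~ lt v w) || (~~ lt w v && ~~ lt u w).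

Lemma between_split y u v w : between u v w -> between u y w || between y v w.
Proof.
rewrite /between; case: (boolP (lt w y)) => wy /=.
  by rewrite (lin_asym ltL wy); case: (lt w u); case: (lt v w); case: (lt w v);
    case: (lt u w); rewrite /= ?orbT.
case: (boolP (lt y w)) => yw /=; first by case: (lt w u); case: (lt v w);
  case: (lt w v); case: (lt u w); rewrite /= ?orbT.
by case: (lt w u); case: (lt v w); case: (lt w v); case: (lt u w); rewrite /= ?orbT.
Qed.

Definition lls : rel X := fun x y => `[< x <<< y >].

(* In the discrete case any two elements are finitely many steps apart, so the
   powers of a map taking [x] to [z] move [x] beyond every bound. *)
Lemma not_discrete x z c d : x <<< z -> tri z x -> c <<< d ->
  (forall e, c <<< e -> ~ e <<< d) -> False.
Proof.
move=> xz zx cd nocd.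
have lls_trans : transitive lls.
  by move=> y u v /asboolP h /asboolP h'; apply/asboolP; apply: (ll_trans h h').
(* Points of one class separated by boundedly many [ll]-steps; for transitivity a chain is cut at
   the middle point by [between_split]. *)
pose K u v := V u v /\ exists n, forall l, sorted lls l -> all (between u v) l -> size l <= n.
have iK : ice K.
  split.
  - move=> g u v Gg; rewrite /K (ice_invE _ _ iV Gg).
    split=> -[Vuv [n hn]]; split=> //; exists n => l sl bl.
      have [h hK] := choice (Gsurj Gg).
      rewrite -(size_map h); apply: hn.
        rewrite sorted_map; apply: sub_sorted sl => s t /asboolP st.
        by apply/asboolP; rewrite -(ll_inv _ _ Gg) !hK.
      have hlt s t : lt (h s) t = lt s (g t) by rewrite -(Glt Gg) hK.
      have hgt s t : lt t (h s) = lt (g t) s by rewrite -(Glt Gg) hK.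
      by rewrite all_map; apply: sub_all bl => s; rewrite /between /= !hlt !hgt.
    rewrite -(size_map g); apply: hn.
      rewrite sorted_map; apply: sub_sorted sl => s t /asboolP st.
      by apply/asboolP; rewrite (ll_inv _ _ Gg).
    by rewrite all_map; apply: sub_all bl => s; rewrite /between /= !(Glt Gg).
  - move=> u; split; first exact: (ice_refl iV).
    exists 1; case=> [|s [|t l]] //= /andP[/asboolP/llt st _] /and3P[].
    rewrite /between !orbb => /andP[su us] /andP[tu ut].
    by move: (lin_le_trans ltL ut su); rewrite st.
  - move=> u v [Vuv [n hn]]; split; first exact: (ice_sym iV).
    exists n => l sl bl; apply: hn => //; apply: sub_all bl => s.
    by rewrite /between orbC.
  - move=> v u w [Vuv [n hn]] [Vvw [m hm]]; split; first exact: (ice_trans iV Vuv Vvw).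
    exists (n + m) => l sl bl.
    rewrite -(count_predC (between u v)) -!size_filter; apply: leq_add.
      by apply: hn; [exact: sorted_filter|exact: filter_all].
    apply: hm; first exact: sorted_filter.
    rewrite all_filter; apply: sub_all bl => s /(between_split v) /=.
    by case: (between u v s).
  - move=> u v w uv vw [Vuw [n hn]]; split; first exact: (ice_convex iV uv vw).
    exists n => l sl bl; apply: hn => //; apply: sub_all bl => s.
    rewrite /between => /orP[/andP[su vs]|/andP[sv us]].
      by rewrite su (lin_le_trans ltL vs (lin_asym ltL vw)).
    by move: (lin_le_trans ltL sv us); rewrite uv.
(* [(c, d)] is in [K] with bound 2, since the middle one of three [ll]-increasing points between
   them would contradict [nocd]. So [K] is not inside [W]. *)
case: (cell_dichotomy iK) => [VK|KW]; last first.
  case: (cd) => cd' Vcd; apply; apply: KW; split=> //.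
  exists 2; case=> [|s [|t [|r l]]] //= /and3P[/asboolP st /asboolP tr _].
  have bt q : between c d q -> ~~ lt q c /\ ~~ lt d q.
    case/orP=> /andP[] // qd cq.
    by move: (lin_le_trans ltL qd cq); rewrite cd'.
  move=> /and4P[/bt[cs sd] _ /bt[cr rd] _].
  have Vcs := ice_betweenl iV Vcd cs sd.
  have ct : c <<< t := le_ll st cs (ice_trans iV Vcs (llV st)).
  case: (nocd t ct); apply: (ll_le tr rd).
  exact: (ice_trans iV (ice_sym iV (llV ct)) Vcd).
have [g Gg gx] := Gtrans x z.
have [up xup hup] := right_pos x.
have [_ [n hn]] := VK x up (llV xup).
have step i : iter i g x <<< iter i.+1 g x.
  by elim: i => [|i IH] /=; rewrite ?gx // (ll_inv _ _ Gg).
have tstep i : tri (iter i.+1 g x) (iter i g x).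
  by elim: i => [|i IH] /=; rewrite ?gx // (Gtri Gg).
have desc i : tri (iter i.+1 g x) x.
  by elim: i => [|i IH]; [exact: (tstep 0)|exact: (lin_trans triL (tstep _) IH)].
have far i : x <<< iter i.+1 g x.
  by elim: i => [|i IH]; [exact: (step 0)|exact: (ll_trans IH (step _))].
(* The points [x, g x, ...] form an [ll]-chain. None exceeds [up]: past [up] it would be [tri]-above
   [x], whereas the iterates decrease for [tri]. *)
suff : size [seq iter i g x | i <- iota 0 n.+1] <= n.
  by rewrite size_map size_iota ltnn.
apply: hn.
  rewrite sorted_map; elim: (n) (0) => //= m IH i.
  by rewrite IH andbT; apply/asboolP/step.
rewrite all_map; apply/allP => i _ /=; apply/orP; left; apply/andP; split.
  case: i => [|i]; first exact: (lin_irr ltL).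
  exact: (lin_asym ltL (llt (far i))).
case: i => [|i]; first exact: (lin_asym ltL (llt xup)).
apply/negP => /(lin_asym ltL) /hup /(_ (llV (far i))) h.
by move: (lin_asym triL h); rewrite desc.
Qed.

Lemma positive_cell x z : x <<< z -> tri x z.
Proof.
move=> xz; apply: contrapT => /negP nt.
have zx : tri z x.
  by rewrite (lin_neg triL (x := x)) // => e; move: (llt xz); rewrite e (negbTE (lin_irr ltL _)).
apply: (not_dense xz zx) => c d cd; apply: contrapT => nex.
by apply: (not_discrete xz zx cd) => e ce ed; apply: nex; exists e.
Qed.

End Cell.
End Invariant.

(** * Levels: counting the sign changes seen beyond a pair *)

Section Levels.
Variables (X : Type) (lt tri : rel X) (G : (X -> X) -> Prop).
Hypothesis ltL : linear lt.
Hypothesis triL : linear tri.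
Hypothesis Gsurj : forall g, G g -> forall y, exists x, g x = y.
Hypothesis Glt : forall g, G g -> forall x y, lt (g x) (g y) = lt x y.
Hypothesis Gtri : forall g, G g -> forall x y, tri (g x) (g y) = tri x y.
Hypothesis Gtrans : forall a b, exists2 g, G g & g a = b.
Hypothesis tri_chains : exists N, forall m, bounded_chains lt (tri m) N.
Hypothesis tri_chains' : exists N, forall m, bounded_chains lt (fun x => tri x m) N.

Local Notation gen := (gen lt G).
Local Notation ice := (ice lt G).

Let igen a b : ice (gen a b).
Proof. exact: gen_ice. Qed.

(** Both pairs are [ll]-related in the cell of [(a, b)], whose two end signs agree. A positive cell
    is settled by [positive_cell]; a negative one becomes positive for the converse of [tri], whose
    sections are bounded by [tri_chains']. *)
Theorem sign_gen a b x y : lt a b -> lt x y -> gen a b x y -> gen x y a b ->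
  tri x y = tri a b.
Proof.
move=> ab xy abxy xyab.
have llab : ll lt G a b a b by apply: ll_ab.
have llxy : ll lt G a b x y.
  by split=> // -[E [iE Exy nE]]; apply: nE; apply: xyab.
have [e he] := sign_right ltL Gsurj Glt Gtrans ab Gtri tri_chains.
have [d hd] := sign_left ltL Gsurj Glt Gtrans ab triL Gtri tri_chains.
have ed := sign_right_left ltL Gsurj Glt Gtrans ab Gtri he hd.
case: e he ed => he ed; rewrite -{}ed in hd.
  have pos := positive_cell ltL Gsurj Glt Gtrans ab triL Gtri tri_chains.
  by rewrite !pos.
pose tri' : rel X := fun u v => tri v u.
have neg u v : lt u v -> tri u v = ~~ tri' u v.
  move=> uv; rewrite /tri' (lin_neg triL (x := u)) ?negbK // => e.
  by move: uv; rewrite e (negbTE (lin_irr ltL _)).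
have pos := @positive_cell X lt G ltL Gsurj Glt Gtrans a b ab tri'
  (linear_converse triL) (fun g Gg u v => Gtri Gg v u) tri_chains'.
have {}pos : forall u v, ll lt G a b u v -> tri' u v.
  apply: pos => u.
    have [v uv hv] := he u; exists v => // w vw Vuw.
    have := hv w vw Vuw; rewrite neg => [/negbFE//|].
    exact: (lin_lt_le_trans ltL (ll_lt uv) vw).
  have [v vu hv] := hd u; exists v => // w vw Vuw.
  have := hv w vw Vuw; rewrite neg => [/negbFE//|].
  exact: (lin_le_lt_trans ltL vw (ll_lt vu)).
by rewrite !neg // !pos.
Qed.

(* For [x < y] the relation [level j x y] says that at least [j] further sign
   changes away from [<] are needed to describe [tri] beyond [y], as seen from [x]:
   [y <= u 0 < ... < u j.-1] with alternating signs, the last one negative. *)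
Definition level (j : nat) (x y : X) : Prop :=
  exists2 u, chain lt (tri x) (~~ odd j) j u & 0 < j -> ~~ lt (u 0) y.

Lemma level0 x y : level 0 x y.
Proof. by exists (fun=> x). Qed.

Lemma level_pred j x y : level j.+1 x y -> level j x y.
Proof.
move=> [u cu yu]; exists (fun i => u i.+1); last first.
  case: j cu yu => // j cu yu _; apply: (lin_le_trans ltL (yu isT)).
  exact: (chain_head_le ltL cu).
by have := chain_tail cu; rewrite /= negbK.
Qed.

Lemma level_leq j k x y : j <= k -> level k x y -> level j x y.
Proof.
move=> /subnK <-; elim: (k - j) => [|m IH] //; rewrite addSn => /level_pred.
exact: IH.
Qed.

Lemma level_le j x y y' : ~~ lt y y' -> level j x y -> level j x y'.
Proof.
move=> y'y [u cu yu]; exists u => // j0; exact: (lin_le_trans ltL y'y (yu j0)).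
Qed.

(** The point [y] itself serves as the new first point of the chain. *)
Lemma level_parity j x y : level j x y -> tri x y = odd j -> level j.+1 x y.
Proof.
move=> [u cu yu] s; exists (ucons y u); last by move=> _; apply: (lin_irr ltL).
rewrite /=; apply: chain_cons => //; first by rewrite s negbK.
move=> j0; have [e|//] := lin_le ltL (yu j0).
by have := cu.1 0 j0; rewrite -e s addbF; case: (odd j).
Qed.

Lemma level_sign j x y : level j x y -> ~ level j.+1 x y -> tri x y = ~~ odd j.
Proof.
move=> lj nlj; apply: contrapT => s; apply: nlj; apply: level_parity => //.
by move: s; case: (tri x y); case: (odd j).
Qed.

Lemma level_bounded : exists N, forall j x y, level j x y -> j <= N.
Proof. by have [N HN] := tri_chains; exists N => j x y [u cu _]; apply: HN cu. Qed.

Lemma level_inv g j x y : G g -> level j x y -> level j (g x) (g y).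
Proof.
move=> Gg [u [h1 h2] yu]; exists (g \o u); last by move=> j0; rewrite (Glt Gg) yu.
by split=> i ij /=; rewrite ?(Glt Gg) ?(Gtri Gg); [exact: h1|exact: h2].
Qed.

(** A map in [G] first makes the left endpoints equal. Lowering the right endpoint is harmless. When
    it rises from [y] to [y'], all points of [[y, y']] have one sign by [sign_gen], so at most the
    first chain point lies below [y'], and [y'] can replace it. *)
Lemma level_gen j x y x' y' : lt x y -> lt x' y' -> gen x y x' y' ->
  level j x y -> level j x' y'.
Proof.
move=> xy x'y' h; have [g Gg gx] := Gtrans x x'.
move=> /(level_inv Gg); move: (xy); rewrite -(Glt Gg) gx => x'gy lv.
have {}h : gen x' (g y) x' y'.
  by move=> E iE; rewrite -gx (ice_invE _ _ iE Gg) gx; apply: h.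
move: (g y) x'gy lv h => {y xy Gg gx g} {}y x'y lv h.
case: (boolP (lt y y')) => yy'; last exact: level_le lv.
have sgn t : ~~ lt t y -> ~~ lt y' t -> tri x' t = tri x' y'.
  move=> yt ty'.
  have x't := lin_lt_le_trans ltL x'y yt.
  apply: sign_gen => //.
    exact: (ice_betweenl ltL (igen _ _) (@gen_self X lt G x' y') (lin_asym ltL x't) ty').
  move=> E iE Ex't; apply: h => //.
  by apply: (ice_betweenl ltL iE Ex't) => //; apply: (lin_asym ltL).
case: lv => u cu yu; case: j cu yu => [|j] cu yu; first exact: level0.
case: (boolP (lt (u 0) y')) => u0y'; last by exists u.
exists (ucons y' (fun i => u i.+1)); last by move=> _; apply: (lin_irr ltL).
rewrite -[~~ odd _]negbK; apply: chain_cons; first exact: chain_tail.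
  rewrite negbK -(sgn (u 0)) ?yu //; first by rewrite (cu.1 0) // addbF.
  exact: (lin_asym ltL).
move=> j0; apply: contrapT => /negP u1y'.
case: (lin_total ltL (u 1) y') => [u1|u1|u1].
- move: (sgn (u 1)) (sgn (u 0)).
  rewrite (lin_asym ltL u1) (lin_asym ltL u0y') (lin_le_trans ltL (yu isT)) ?yu //.
    move=> /(_ isT isT) s1 /(_ isT isT); rewrite -s1 (cu.1 0) // (cu.1 1) //.
    by rewrite /= negbK; case: (odd j).
  exact: (chain_head_le ltL cu).
- move: (sgn (u 0)); rewrite (lin_asym ltL u0y') ?yu // => /(_ isT isT).
  by rewrite -u1 (cu.1 0) // (cu.1 1) //= negbK; case: (odd j).
- by rewrite u1 in u1y'.
Qed.

Definition levelrel (j : nat) (x y : X) : Prop :=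
  [\/ x = y, lt x y /\ level j x y | lt y x /\ level j y x].

Lemma levelrel_lt j x y : lt x y -> levelrel j x y <-> level j x y.
Proof.
move=> xy; split=> [[e|[]|[yx]]|h] //; last by constructor 2.
- by move: xy; rewrite e (negbTE (lin_irr ltL _)).
- by move: (lin_asym ltL xy); rewrite yx.
Qed.

Lemma levelrel_sym j x y : levelrel j x y -> levelrel j y x.
Proof. by case=> [->|h|h]; [constructor 1|constructor 3|constructor 2]. Qed.

Lemma levelrel_gen j x y x' y' : x <> y -> gen x y x' y' ->
  levelrel j x y -> levelrel j x' y'.
Proof.
have gen_sym a b u v : gen a b u v -> gen b a u v.
  by move=> h E iE /(ice_sym iE); apply: h.
wlog xy : x y / lt x y.
  move=> H ne h l; case: (lin_total ltL x y) => // xy; first exact: H h l.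
  by apply: (H y x) => //; [exact: nesym|exact: gen_sym|exact: levelrel_sym].
wlog xy' : x' y' / lt x' y'.
  move=> H ne h l; case: (lin_total ltL x' y') => xy'; first exact: H.
    by constructor 1.
  by apply: levelrel_sym; apply: H => //; apply: (ice_sym (igen _ _)).
move=> _ h /(levelrel_lt _ xy) l; apply/levelrel_lt => //; exact: level_gen h l.
Qed.

(** Invariance, convexity and transitivity follow from [levelrel_gen]: for transitivity, the larger
    of the comparable relations generated by [(x, y)] and [(y, z)] contains [(x, z)]. *)
Lemma levelrel_ice j : ice (levelrel j).
Proof.
have ne g x y : G g -> x <> y -> g x <> g y.
  move=> Gg nxy e; case: (lin_total ltL x y) => // h; move: h;
  by rewrite -(Glt Gg) e (negbTE (lin_irr ltL _)).
split.
- move=> g x y Gg; case: (pselect (x = y)) => [->|nxy]; first by split; constructor 1.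
  split; apply: levelrel_gen => //; try exact: ne.
    by move=> E iE; rewrite (ice_invE _ _ iE Gg).
  by move=> E iE; rewrite (ice_invE _ _ iE Gg).
- by constructor 1.
- exact: levelrel_sym.
- move=> y x z; case: (pselect (x = y)) => [->//|nxy].
  case: (pselect (y = z)) => [->//|nyz] lxy lyz.
  case: (ice_comparable ltL Glt Gtrans (igen x y) (igen y z)) => h.
    apply: levelrel_gen lyz => //; apply: (ice_trans (igen _ _) _ (@gen_self X lt G y z)).
    by apply: h; exact: gen_self.
  apply: levelrel_gen lxy => //; apply: (ice_trans (igen _ _) (@gen_self X lt G x y)).
  by apply: h; exact: gen_self.
- move=> x y z xy yz; apply: levelrel_gen.
    by move=> e; move: (lin_trans ltL xy yz); rewrite e (negbTE (lin_irr ltL _)).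
  exact: (ice_convex (igen _ _) xy yz (@gen_self X lt G x z)).
Qed.

(** * The largest level, and complements of levels *)

Section MaximalLevel.
Variable K : nat.
Hypothesis Kmax : forall j x y, lt x y -> level j x y -> j <= K.
Hypothesis Kattained : 0 < K -> exists x y, lt x y /\ level K x y.

Lemma level_chain i x u : chain lt (tri x) (~~ odd K) K u -> i < K ->
  level (K - i) x (u i).
Proof.
move=> [h1 h2] iK; exists (fun t => u (i + t)); last by rewrite addn0 => _; apply: (lin_irr ltL).
split=> t; rewrite ltn_subRL => tK; last by rewrite addnS; apply: h2; rewrite -addnS.
by rewrite h1 // oddD oddB 1?ltnW // addNb addNb addbA.
Qed.

(** Each step costs a level: if [u i.+1] had level [K - i], its sign would fit [level_parity] and
    give level [(K - i).+1] to it, hence to the smaller [u i]. *)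
Lemma level_chain_exact m x u : chain lt (tri x) (~~ odd K) m u -> m <= K.+1 ->
  lt x (u 0) -> forall i, i < m -> ~ level (K - i).+1 x (u i).
Proof.
move=> cu mK xu0; elim=> [_|i IH im] lv.
  by move: (Kmax xu0 lv); rewrite subn0 ltnn.
have iK : i < K by rewrite -ltnS; apply: leq_trans mK.
move: lv; rewrite subnSK // => lv; apply: (IH (ltnW im)).
apply: (@level_le _ _ (u i.+1)); first exact: (lin_asym ltL (cu.2 _ im)).
apply: level_parity => //; rewrite (cu.1 _ im) oddB 1?ltnW //=.
by case: (odd K); case: (odd i).
Qed.

Lemma attain x : 0 < K -> exists2 y, lt x y & level K x y.
Proof.
move=> /Kattained[x' [y [xy lv]]]; have [g Gg <-] := Gtrans x' x.
by exists (g y); [rewrite (Glt Gg)|exact: level_inv].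
Qed.

Lemma attain_chain x : 0 < K ->
  exists2 u, chain lt (tri x) (~~ odd K) K u & lt x (u 0).
Proof.
move=> K0; have [y xy [u cu yu]] := attain x K0; exists u => //.
exact: (lin_lt_le_trans ltL xy (yu K0)).
Qed.

Lemma level_exact j x : 0 < j <= K ->
  exists2 y, lt x y & level j x y /\ ~ level j.+1 x y.
Proof.
move=> /andP[j0 jK]; have [u cu xu] := attain_chain x (leq_trans j0 jK).
have iK : K - j < K by rewrite ltn_subrL j0 (leq_trans j0 jK).
exists (u (K - j)).
  exact: (lin_lt_le_trans ltL xu (chain_head_le ltL cu iK)).
split; first by have := level_chain cu iK; rewrite subKn.
by have := level_chain_exact cu (leqnSn K) xu iK; rewrite subKn.
Qed.

(** Makes the failure of a level existential, as the definability argument requires: [(K - j).+2]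
    alternating points up to [y], starting with the sign of a maximal chain, leave fewer than [j]
    beyond [y]. *)
Lemma not_levelP j x y : lt x y -> 0 < j <= K ->
  (~ level j x y) <-> exists u, [/\ chain lt (tri x) (~~ odd K) (K - j).+2 u,
    lt x (u 0) & ~~ lt y (u (K - j).+1)].
Proof.
move=> xy /andP[j0 jK]; split; last first.
  move=> [u [cu xu uy]] lv; have sz : (K - j).+2 <= K.+1.
    by rewrite ltnS ltn_subrL j0 (leq_trans j0 jK).
  have := level_chain_exact cu sz xu (ltnSn _).
  rewrite subnS subKn // prednK //; apply; exact: level_le lv.
move=> nlv; have [u cu xu] := attain_chain x (leq_trans j0 jK).
have iK : K - j < K by rewrite ltn_subrL j0 (leq_trans j0 jK).
(* [u (K - j)] has level [j], so it precedes [y]. The required chain ends at [y] if the sign there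
   is [odd j], and at [u (K - j).+1] otherwise. *)
have uy : lt (u (K - j)) y.
  apply: contrapT => /negP yu; apply: nlv.
  by apply: level_le yu _; have := level_chain cu iK; rewrite subKn.
have oe : ~~ odd K (+) odd (K - j).+1 = odd j.
  by rewrite /= oddB //; case: (odd K); case: (odd j).
case: (boolP (tri x y == odd j)) => [/eqP s|s].
  exists (urcons u (K - j).+1 y); split; rewrite /urcons ?ltnn ?ltn0Sn //.
    apply: chain_rcons => //; first exact: (chain_take cu).
    by rewrite s oe.
  exact: (lin_irr ltL).
(* For [j = 1] the index [(K - j).+1] is past the chain, but then the sign at [y] already gives
   level 1. *)
case: j j0 jK nlv iK uy oe s => // -[|j] _ jK nlv iK uy oe s.
  by case: nlv; apply: (level_parity (level0 _ _)); move: s; case: (tri x y).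
have jK' : K - j.+2 < K - j.+1 by rewrite ltn_sub2l.
have jK'' : (K - j.+2).+1 < K by rewrite subnSK // ltn_subrL; apply: leq_trans jK.
exists u; split=> //; first by apply: (chain_take cu); exact: jK''.
apply/negP => yu; apply: nlv; apply: level_parity; last first.
  by move: s => /=; rewrite negbK; case: (tri x y); case: (odd j).
apply: (level_le (lin_asym ltL yu)).
by have := level_chain cu jK''; rewrite subnSK // subKn // ltnW.
Qed.

End MaximalLevel.
End Levels.

(** * Representations by iterated reversal: existence and uniqueness *)

Local Open Scope classical_set_scope.
Local Open Scope card_scope.

(** The members satisfying [P] form a final segment of the list, so their number decides which ones
    they are. *)
Lemma count_nested (T : Type) (x0 : T) (P : pred T) (s : seq T) :
  (forall i j, i < j < size s -> P (nth x0 s i) -> P (nth x0 s j)) ->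
  forall i, i < size s -> P (nth x0 s i) = (size s - i <= count P s).
Proof.
elim: s => [|a s IH] // nest.
have Pa : P a -> count P s = size s.
  move=> ha; apply/eqP; rewrite -all_count; apply/(all_nthP x0) => i il.
  exact: (nest 0 i.+1).
case=> [_|i] /=.
  rewrite subn0; case: (boolP (P a)) => ha; first by rewrite Pa // leqnn.
  by rewrite add0n ltnNge count_size.
rewrite ltnS subSS => il; rewrite IH //; last by move=> k j kj; apply: (nest k.+1 j.+1).
case: (boolP (P a)) => ha; last by rewrite add0n.
by rewrite Pa // !leq_subr (leq_trans (leq_subr _ _)) // leq_addl.
Qed.

Lemma count_leq_iota m k : m <= k -> count (fun j => j <= m) (iota 1 k) = m.
Proof.
move=> mk; have -> : count (fun j => j <= m) (iota 1 k) = minn m k.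
  elim: k {mk} => [|k IH]; first by rewrite minn0.
  rewrite -{1}(addn1 k) iotaD count_cat IH /= addn0 add1n.
  case: (boolP (k < m)) => [km|]; last rewrite -leqNgt => km.
    by rewrite (minn_idPr (ltnW km)) (minn_idPr km) addn1.
  by rewrite (minn_idPl km) (minn_idPl (leqW km)) addn0.
exact/minn_idPl.
Qed.

Section Representation.
Variables (X : Type) (lt tri : set (X * X)) (G : (X -> X) -> Prop).
Variable Dfn : set (set (X * X)).
Let ltb : rel X := fun x y => `[< lt (x, y) >].
Let trib : rel X := fun x y => `[< tri (x, y) >].

Hypothesis ltO : strict_linear_order lt.
Hypothesis triO : strict_linear_order tri.
Hypothesis Glt : forall g, G g -> forall x y, ltb (g x) (g y) = ltb x y.
Hypothesis Gtri : forall g, G g -> forall x y, trib (g x) (g y) = trib x y.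
Hypothesis Gtrans : forall a b, exists2 g, G g & g a = b.
Hypothesis tri_chains : exists N, forall m, bounded_chains ltb (trib m) N.
Hypothesis Dfn_ice : forall E, Dfn E -> ice ltb G (fun x y => E (x, y)).
Hypothesis Dfn_id : Dfn (@id_rel X).
Local Notation level := (level ltb trib).

Definition level_set j : set (X * X) := [set xy | levelrel ltb trib j xy.1 xy.2].

(** The guard [0 < K] allows [K = 0] on a one-point set, where no pair exists. *)
Definition maximal_level K :=
  (forall j x y, ltb x y -> level j x y -> j <= K) /\
  (0 < K -> exists x y, ltb x y /\ level K x y).

Hypothesis Dfn_level : forall K j, maximal_level K -> 0 < j <= K -> Dfn (level_set j).

Lemma linear_asbool (r : set (X * X)) :
  strict_linear_order r -> linear (fun x y => `[< r (x, y) >]).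
Proof.
move=> [irr trans tot]; split=> [x|y x z /asboolP xy /asboolP yz|x y].
- by apply/asboolP/irr.
- by apply/asboolP; apply: trans xy yz.
- case: (tot x y) => h; [constructor 1|constructor 2|constructor 3] => //;
  exact/asboolP.
Qed.

Let ltL : linear ltb := linear_asbool ltO.
Let triL : linear trib := linear_asbool triO.

Let lt_ne x y : ltb x y -> x <> y.
Proof. by move=> xy e; move: xy; rewrite e (negbTE (lin_irr ltL _)). Qed.

Definition flips (Es : seq (set (X * X))) xy := count (fun E => `[< E xy >]) Es.

(** Each relation containing the pair exchanges [x] and [y] once; by symmetry it contains both
    orders or neither, so only the parity matters. *)
Lemma reverse_in_seqE Es (r : set (X * X)) x y :
  (forall i, i < size Es -> forall x y, nth set0 Es i (x, y) -> nth set0 Es i (y, x)) ->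
  reverse_in_seq r Es (x, y) <-> if odd (flips Es (x, y)) then r (y, x) else r (x, y).
Proof.
elim: Es r => [|E Es IH] r sym //=.
rewrite (IH (reverse_in r E)); last by move=> i il; apply: (sym i.+1).
have sE := sym 0 isT; rewrite oddD.
case: (asboolP (E (x, y))) => Exy; case: (odd (flips Es (x, y))); rewrite /reverse_in /=.
- have Eyx := sE _ _ Exy; tauto.
- tauto.
- have nEyx : ~ E (y, x) by move=> /sE.
  tauto.
- tauto.
Qed.

Definition is_representation (Es : seq (set (X * X))) :=
  [/\ forall i : nat, (i < size Es)%N -> Dfn (nth set0 Es i),
      strictly_increasing Es,
      ohead Es = Some (@id_rel X) &
      tri = reverse_in_seq lt Es].

Section Uniqueness.
Variable Es : seq (set (X * X)).
Hypothesis rep : is_representation (@id_rel X :: Es).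

Let ie i : i < size Es -> ice ltb G (fun x y => nth set0 Es i (x, y)).
Proof. by case: rep => h _ _ _ il; apply/Dfn_ice/(h i.+1). Qed.

Lemma nth_flips i xy : i < size Es ->
  nth set0 Es i xy <-> size Es - i <= flips Es xy.
Proof.
move=> il; rewrite -(@count_nested _ set0 (fun E => `[< E xy >])) //.
  by split=> [h|/asboolP//]; apply/asboolP.
move=> k j /andP[kj jl] /asboolP h; apply/asboolP.
case: rep => _ /(_ k.+1 j.+1) /= + _ _.
by rewrite !ltnS kj jl => /(_ isT) [+ _]; apply.
Qed.

Lemma flips_le_size xy : flips Es xy <= size Es.
Proof. exact: count_size. Qed.

Lemma sign_flips x y : ltb x y -> trib x y = ~~ odd (flips Es (x, y)).
Proof.
move=> xy; case: rep => hD _ _ e; rewrite /trib e.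
have ne := lt_ne xy.
have -> : flips Es (x, y) = flips (@id_rel X :: Es) (x, y).
  by rewrite /flips /= [`[< _ >]](_ : _ = false) //; apply/asboolP.
have symE i : i < size (@id_rel X :: Es) -> forall x y,
    nth set0 (@id_rel X :: Es) i (x, y) -> nth set0 (@id_rel X :: Es) i (y, x).
  by move=> il u v; apply: (ice_sym (Dfn_ice (hD i il))).
apply/asboolP/idP; rewrite (reverse_in_seqE _ _ _ symE).
  case: odd => // /asboolP yx.
  by move: (lin_asym ltL xy); rewrite /ltb yx.
by move=> /negbTE ->; apply/asboolP.
Qed.

Lemma flips_anti x y y' : ltb x y -> ~~ ltb y' y ->
  flips Es (x, y') <= flips Es (x, y).
Proof.
move=> xy yy'; rewrite leqNgt; apply/negP => lt_f.
set m := flips Es (x, y') in lt_f.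
have m0 : 0 < m by apply: leq_ltn_trans lt_f.
have mn : m <= size Es by apply: flips_le_size.
have il : size Es - m < size Es by rewrite ltn_subrL m0 (leq_trans m0 mn).
have : nth set0 Es (size Es - m) (x, y') by apply/(nth_flips _ il); rewrite subKn.
move=> /(ice_betweenl ltL (ie il)) /(_ (lin_asym ltL xy) yy').
by move=> /(nth_flips _ il); rewrite subKn // leqNgt lt_f.
Qed.

(** Strict inclusion provides a pair in one relation but not in its predecessor, lying in exactly
    [j] relations; a map in [G] moves its left endpoint to [x]. *)
Lemma flips_attained x j : 0 < j <= size Es ->
  exists2 y, ltb x y & flips Es (x, y) = j.
Proof.
move=> /andP[j0 jn].
have il : size Es - j < size Es by rewrite ltn_subrL j0 (leq_trans j0 jn).
case: (rep) => hD /(_ (size Es - j) (size Es - j).+1) /= + _ _.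
rewrite ltnSn ltnS il => /(_ isT).
(* [E'] is the predecessor of entry [i], as its index counts the identity in front; for [i = 0] it
   is the identity. *)
set i := size Es - j in il *; set E' := nth set0 (_ :: _) i => inc.
have iE' : ice ltb G (fun x y => E' (x, y)) by apply/Dfn_ice/hD; apply: ltnW.
have [[w z] [Ewz nE'wz]] : exists wz, nth set0 Es i wz /\ ~ E' wz.
  apply: contrapT => nex; case: inc => _; apply => wz Ewz.
  by apply: contrapT => n; apply: nex; exists wz.
wlog wz : w z Ewz nE'wz / ltb w z.
  move=> H; case: (lin_total ltL w z) => [|e|zw]; first exact: H.
    by case: nE'wz; rewrite e; apply: (ice_refl iE').
  apply: (H z w) => //; first exact: (ice_sym (ie il)).
  by move=> /(ice_sym iE').
have [g Gg <-] := Gtrans w x; exists (g z); first by rewrite (Glt Gg).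
have : nth set0 Es i (g w, g z) by rewrite (ice_invE w z (ie il) Gg).
move=> /(nth_flips _ il); rewrite subKn // leq_eqVlt => /orP[/eqP//|lt_f].
case: nE'wz; rewrite -(ice_invE w z iE' Gg) /E'.
move: (erefl i); rewrite {1}/i; case: i {E' inc iE'} il {Ewz} => [_ e|k il e] /=.
  by move: (flips_le_size (g w, g z)); rewrite leqNgt (leq_trans _ lt_f) // ltnS -subn_eq0 e.
apply/nth_flips; first exact: ltnW.
by rewrite -subSS -e subSn ?leq_subr // subKn.
Qed.

(** To the right of [x], [flips] decreases weakly, takes every value from 1 to [size Es], and its
    parity gives the sign. So an alternating chain loses a flip at each step, and points with
    prescribed [flips] supply chains. Hence [flips] depends only on the two orders, which yields
    uniqueness. *)
Lemma level_flips x y j : ltb x y -> level j x y <-> j <= flips Es (x, y).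
Proof.
move=> xy; split.
  elim: j y xy => [|j IH] y xy // [u cu yu].
  have xu0 : ltb x (u 0) := lin_lt_le_trans ltL xy (yu isT).
  apply: leq_trans (flips_anti xy (yu isT)).
  have le_f : j <= flips Es (x, u 0).
    case: j IH cu yu => [|j] IH cu yu //.
    have u01 := cu.2 0 isT.
    apply: leq_trans (flips_anti xu0 (lin_asym ltL u01)).
    apply: IH; first exact: (lin_trans ltL xu0 u01).
    exists (fun i => u i.+1) => [|_]; last exact: (lin_irr ltL).
    by have := chain_tail cu; rewrite /= negbK.
  rewrite ltn_neqAle le_f andbT; apply/eqP => e.
  move: (cu.1 0 isT); rewrite sign_flips // -e /= addbF.
  by case: (odd j).
elim: j y xy => [|j IH] y xy jf; first exact: level0.
have [y' [xy' yy' e]] : exists y', [/\ ltb x y', ~~ ltb y' y & flips Es (x, y') = j.+1].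
  move: jf; rewrite leq_eqVlt => /orP[/eqP e|lt_f].
    by exists y; split=> //; apply: (lin_irr ltL).
  have [|y' xy' e] := @flips_attained x j.+1.
    by rewrite /= (leq_trans (ltnW lt_f)) // flips_le_size.
  exists y'; split=> //; apply/negP => y'y.
  by move: (flips_anti xy' (lin_asym ltL y'y)); rewrite e leqNgt lt_f.
apply: (level_le ltL yy'); apply: (level_parity ltL); last first.
  by rewrite sign_flips // e /= negbK.
by apply: IH => //; rewrite e.
Qed.

Lemma representation_maximal : maximal_level (size Es).
Proof.
split=> [j x y xy /(level_flips _ xy) h|n0].
  exact: leq_trans h (flips_le_size _).
case: (rep) => _ /(_ 0 1) /= + _ _; rewrite ltnS n0 => /(_ isT) [_ nsub].
have [[x y] ne] : exists xy : X * X, xy.1 <> xy.2.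
  apply: contrapT => nex; apply: nsub => -[x y] _; apply: contrapT => ne.
  by apply: nex; exists (x, y).
have [|y' xy' e] := @flips_attained x (size Es); first by rewrite n0 /=.
by exists x, y'; split=> //; apply/level_flips => //; rewrite e.
Qed.

Lemma representation_nth i : i < size Es -> nth set0 Es i = level_set (size Es - i).
Proof.
move=> il; rewrite predeqE => -[x y].
wlog xy : x y / ltb x y.
  move=> H; case: (lin_total ltL x y) => [|->|yx]; first exact: H.
    by split=> _; [constructor 1|apply: (ice_refl (ie il))].
  split=> [/(ice_sym (ie il)) /(H _ _ yx)|h]; first exact: levelrel_sym.
  by apply: (ice_sym (ie il)); apply/(H _ _ yx); apply: levelrel_sym.
rewrite (nth_flips _ il) -(level_flips _ xy); symmetry; exact: levelrel_lt.
Qed.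

(** For [x < y], the last relation is level 1: it contains [(x, y)] iff some [u >= y] is not
    [tri]-above [x]. A pair outside it thus provides the final segment. *)
Lemma same_orientationE :
  same_orientation lt tri <-> last (@id_rel X) Es <> setT.
Proof.
have lastE x y : ltb x y -> last (@id_rel X) Es (x, y) <-> level 1 x y.
  move=> xy; rewrite (level_flips _ xy) (last_nth set0).
  case: (posnP (size Es)) => [/size0nil -> /=|n0].
    by split=> // e; case: (lt_ne xy).
  rewrite -(prednK n0) /= nth_flips ?prednK //.
  by rewrite -{1}(prednK n0) subSnn.
have last_ice : ice ltb G (fun x y => last (@id_rel X) Es (x, y)).
  case: (rep) => hD _ _ _; apply: Dfn_ice.
  by rewrite (last_nth set0); apply: hD.
split.
  move=> [a [F [[u Fu] final sub]]] e.
  case: (lin_total ltL a u) => [au|eau|/asboolP ua].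
  - have /(lastE _ _ au) [w cw wu] : last (@id_rel X) Es (a, u) by rewrite e.
    have Fw : F (w 0).
      by case: (lin_le ltL (wu isT)) => [<-//|/asboolP]; apply: final.
    have := cw.1 0 isT; rewrite /trib /= => /asboolP; apply; exact: sub.
  - by move: (sub _ Fu); rewrite /= eau; case: triO => irr _ _; apply: irr.
  - by move: (sub _ (final _ _ Fu ua)); case: triO => irr _ _; apply: irr.
move=> neT.
have [[x y] nxy] : exists xy, ~ last (@id_rel X) Es xy.
  apply: contrapT => nex; apply: neT; rewrite predeqE => xy; split=> // _.
  by apply: contrapT => n; apply: nex; exists xy.
wlog xy : x y nxy / ltb x y.
  move=> H; case: (lin_total ltL x y) => [|e|yx]; first exact: H nxy.
    by case: nxy; rewrite e; apply: (ice_refl last_ice).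
  by apply: (H y x) => // /(ice_sym last_ice).
exists x, [set u | ~~ ltb u y]; split; first by exists y; apply: (lin_irr ltL).
  move=> u v /= yu /asboolP uv; apply: (lin_asym ltL).
  exact: (lin_le_lt_trans ltL yu uv).
move=> u /= yu; apply: contrapT => ntri; apply: nxy; apply/lastE => //.
exists (fun=> u) => //; split=> -[|i] // _.
by rewrite /trib /=; apply/asboolP.
Qed.

End Uniqueness.

(** Higher levels are smaller relations, hence the reversal. *)
Definition level_seq K := @id_rel X :: [seq level_set j | j <- rev (iota 1 K)].

Lemma level_seq_nth K i : i < K ->
  nth set0 [seq level_set j | j <- rev (iota 1 K)] i = level_set (K - i).
Proof.
move=> iK; rewrite (nth_map 0) ?size_rev ?size_iota // nth_rev ?size_iota //.
rewrite nth_iota; last by rewrite ltn_subrL (leq_ltn_trans _ iK).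
by rewrite add1n subnSK.
Qed.

Lemma representation_unique K Es : maximal_level K -> is_representation Es ->
  Es = level_seq K.
Proof.
move=> [Kmax Kat] rep; have [_ _ +_] := rep; case: Es rep => //= E Es rep [e].
rewrite {}e in rep *; have [max at_] := representation_maximal rep.
have sz : size Es = K.
  apply/eqP; rewrite eqn_leq; apply/andP; split.
    case: (posnP (size Es)) => [->//|/at_[x [y [xy lv]]]]; exact: Kmax xy lv.
  case: (posnP K) => [->//|/Kat[x [y [xy lv]]]]; exact: max xy lv.
congr (_ :: _); apply: (@eq_from_nth _ set0).
  by rewrite size_map size_rev size_iota.
by move=> i il; rewrite (representation_nth rep) // level_seq_nth ?sz // -sz.
Qed.

(** The number of levels containing an increasing pair is its largest level, whose parity is the
    sign by [level_sign]; strict inclusions come from points of exact level. *)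
Lemma level_seq_representation K : maximal_level K -> is_representation (level_seq K).
Proof.
move=> Km; have [Kmax Kat] := Km.
have szK : size [seq level_set j | j <- rev (iota 1 K)] = K.
  by rewrite size_map size_rev size_iota.
have range i : i < K -> 0 < K - i <= K by move=> iK; rewrite subn_gt0 iK leq_subr.
have exact_ := level_exact ltL Glt Gtri Gtrans Kmax Kat.
split=> //.
- move=> [|i] /=; rewrite ?ltnS szK => iK //; rewrite level_seq_nth //.
  exact: Dfn_level (range _ iK).
- move=> [|i] [|j] //=; rewrite ?ltnS szK => h.
    rewrite level_seq_nth //; split=> [[x y] e|sub]; first by constructor 1.
    have [[w z] _] : exists xy : X * X, True.
      have K0 : 0 < K by apply: leq_ltn_trans h.
      by have [x [y _]] := Kat K0; exists (x, y).
    have [y' xy [lv _]] := exact_ _ w (range _ h).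
    by apply: (lt_ne xy); apply: (sub (w, y')); constructor 2.
  case/andP: h => ij jK; have iK := ltn_trans ij jK.
  rewrite !level_seq_nth //; have lt_K : K - j < K - i by rewrite ltn_sub2l.
  split=> [[x y]|sub].
    case=> [e|[xy lv]|[xy lv]]; [by constructor 1|constructor 2|constructor 3]; split=> //.
      exact: (level_leq ltL (ltnW lt_K)).
    exact: (level_leq ltL (ltnW lt_K)).
  have K0 : 0 < K by apply: leq_ltn_trans jK.
  have [x _] := Kat K0; have [y xy [lv nlv]] := exact_ _ x (range _ jK).
  apply: nlv; apply: (level_leq ltL lt_K); apply/(levelrel_lt _ ltL _ xy).
  by apply: (sub (x, y)); constructor 2.
rewrite predeqE => -[x y].
have symE i : i < size (level_seq K) -> forall x y,
    nth set0 (level_seq K) i (x, y) -> nth set0 (level_seq K) i (y, x).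
  case: i => [|i] /=; first by move=> _ u v /esym.
  by rewrite ltnS szK => iK u v; rewrite level_seq_nth //; apply: levelrel_sym.
have flipsE u v : ltb u v -> trib u v = ~~ odd (flips (level_seq K) (u, v)).
  move=> uv; have [j lj jmax] := @max_nat (fun j => level j u v) K
    (ex_intro (fun j => level j u v) 0 (level0 _ _ _ _)) (fun j => Kmax j u v uv).
  have jK := Kmax _ _ _ uv lj.
  have -> : flips (level_seq K) (u, v) = j.
    rewrite /flips /= [`[< _ >]](_ : _ = false) ?add0n; last by apply/asboolP/(lt_ne uv).
    rewrite count_map count_rev -[RHS](count_leq_iota jK).
    apply: eq_count => m /=; apply/asboolP/idP => [/(levelrel_lt _ ltL _ uv)|mj].
      exact: jmax.
    by apply/(levelrel_lt _ ltL _ uv)/(level_leq ltL mj).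
  apply: (level_sign ltL lj) => /jmax; by rewrite ltnn.
rewrite (reverse_in_seqE _ _ _ symE).
have flips_sym : flips (level_seq K) (x, y) = flips (level_seq K) (y, x).
  have hall s : (forall i, i < size s -> forall x y,
      nth set0 s i (x, y) -> nth set0 s i (y, x)) -> flips s (x, y) = flips s (y, x).
    elim: s => [|E s IH] // hs; rewrite /flips /= -/(flips s _) -/(flips s _).
    rewrite IH => [|i il]; last exact: (hs i.+1).
    by congr (nat_of_bool _ + _); apply/asboolP/asboolP; apply: (hs 0 isT).
  exact: hall.
case: (ltO) => lirr ltrans _; case: (triO) => tirr ttrans ttot.
case: (lin_total ltL x y) => [xy|->|yx].
- have := flipsE _ _ xy; rewrite /trib; case: odd => /= [/asboolP|/asboolP] h.
    split=> // /asboolP yx; by move: (lin_asym ltL xy); rewrite /ltb yx.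
  by split=> // _; apply/asboolP.
- by split=> [/tirr|] //; case: odd => /lirr.
- have := flipsE _ _ yx; rewrite flips_sym; rewrite /trib; case: odd => /= [/asboolP|/asboolP] h.
    split=> [_|_]; first by apply/asboolP.
    case: (ttot x y) => [//|e|]; first by case: (lt_ne yx).
    by move=> /h.
  split=> [xy|/asboolP xy]; first by case: (tirr x); apply: ttrans xy h.
  by move: (lin_asym ltL yx); rewrite /ltb xy.
Qed.

Lemma maximal_level_exists : exists K, maximal_level K.
Proof.
have [N HN] := @level_bounded _ ltb trib tri_chains.
have [||K [Q1 Q2] Kmax] := @max_nat (fun K =>
  (0 < K -> exists x y, ltb x y /\ level K x y) /\ K <= N) N.
- by exists 0.
- by move=> k [].
exists K; split=> // j x y xy lv; apply: Kmax; split; last exact: HN lv.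
by exists x, y.
Qed.

End Representation.

(** * Renaming of variables and automorphisms *)

Section Syntax.
Variable L : language.

Fixpoint tren (V W : sorts L -> Type) (f : forall s, V s -> W s) s (t : term V s) :
    term W s :=
  match t in term _ s return term W s with
  | Var _ v => Var (f _ v)
  | App h args => App (fun i => tren f (args i))
  end.

Definition ext_map (S : Type) (V W : S -> Type) (f : forall s, V s -> W s) s0 s
    (v : ext V s0 s) : ext W s0 s :=
  match v in ext _ _ s return ext W s0 s with
  | Old _ w => Old s0 (f _ w)
  | New => New W s0
  end.

Fixpoint ren (V W : sorts L -> Type) (f : forall s, V s -> W s) (phi : form V) :
    form W :=
  match phi with
  | Bot => Bot
  | Eq _ t u => Eq (tren f t) (tren f u)
  | Rel r args => Rel (fun i => tren f (args i))
  | Imp phi psi => Imp (ren f phi) (ren f psi)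
  | All s0 phi => All (ren (@ext_map _ V W f s0) phi)
  end.

Variable M : structure L.

Lemma env_eq (V : sorts L -> Type) (e e' : env V M) :
  (forall s v, e s v = e' s v) -> e = e'.
Proof. by move=> h; apply: functional_extensionality_dep => s; apply/funext. Qed.

Lemma eval_tren (V W : sorts L -> Type) (f : forall s, V s -> W s) (e : env W M)
    s (t : term V s) :
  eval e (tren f t) = eval (fun s v => e s (f s v)) t.
Proof.
elim: t => [//|h args IH] /=; congr finterp.
by apply: functional_extensionality_dep => i; apply: IH.
Qed.

Lemma sat_ren (V W : sorts L -> Type) (f : forall s, V s -> W s) (e : env W M)
    (phi : form V) :
  sat e (ren f phi) <-> sat (fun s v => e s (f s v)) phi.
Proof.
elim: phi W f e => [V'|V' s t u|V' r args|V' phi IH psi IH'|V' s0 phi IH] W f e //=.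
- by rewrite !eval_tren.
- have -> // : (fun i => eval e (tren f (args i))) =
      (fun i => eval (fun s v => e s (f s v)) (args i)).
  by apply: functional_extensionality_dep => i; rewrite eval_tren.
- by rewrite IH IH'.
- split=> h a; have := h a; rewrite IH;
  by congr (sat _ phi); apply: env_eq => s [].
Qed.

Variable g : forall s, M s -> M s.
Hypothesis gaut : automorphism g.

Lemma eval_aut (V : sorts L -> Type) (e : env V M) s (t : term V s) :
  eval (fun s v => g (e s v)) t = g (eval e t).
Proof.
elim: t => [//|h args IH] /=; rewrite (aut_fun gaut); congr finterp.
by apply: functional_extensionality_dep => i; apply: IH.
Qed.

Lemma sat_aut (V : sorts L -> Type) (e : env V M) (phi : form V) :
  sat (fun s v => g (e s v)) phi <-> sat e phi.
Proof.
elim: phi e => [V'|V' s t u|V' r args|V' phi IH psi IH'|V' s0 phi IH] e //=.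
- rewrite !eval_aut; split=> [|->//]; exact: (bij_inj (aut_bij gaut s)).
- have -> : (fun i => eval (fun s v => g (e s v)) (args i)) =
      (fun i => g (eval e (args i))).
    by apply: functional_extensionality_dep => i; rewrite eval_aut.
  by rewrite -(aut_rel gaut).
- by rewrite IH IH'.
- have E a : (fun s v => g (extend e a v)) = extend (fun s v => g (e s v)) (g a).
    by apply: env_eq => s [].
  split=> h a; first by have := h (g a); rewrite -E IH.
  have [k gk kg] := aut_bij gaut s0.
  by rewrite -(kg a) -E IH.
Qed.

End Syntax.

(** * Transitivity of the automorphism group *)

Lemma card_leTT (T U : Type) :
  [set: T] #<= [set: U] <-> exists f : T -> U, injective f.
Proof.
split=> [/card_leP[f]|[f finj]].
  exists (fun t => val (f (to_setT t))) => x y /val_inj /inj.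
  by rewrite !in_setT => /(_ isT isT) /(congr1 val).
have [h] : $|{injfun [set: T] >-> [set: U]}|.
  by apply/injfunPex; exists f => // x y _ _; apply: finj.
exact: inj_card_le.
Qed.

(** If [Y] is infinite, the [n] new points are absorbed by shifting a copy of [nat] inside [Y]; if
    it is finite, so is [T], while [K] is infinite. *)
Lemma card_lt_add_finite (T Y K : Type) (n : nat) (h : T -> Y + 'I_n) :
  [set: nat] #<= [set: K] -> card_lt Y K -> injective h -> card_lt T K.
Proof.
move=> natK [YK nKY] hinj.
have TYn : [set: T] #<= [set: Y + 'I_n] by apply/card_leTT; exists h.
case: (pselect ([set: nat] #<= [set: Y])) => [/card_leTT[u uinj]|/finite_setPn fY].
  have YnY : [set: Y + 'I_n] #<= [set: Y].
    pose f (z : Y + 'I_n) := match z with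
      | inl y => if pselect (exists k, y = u k) is left e then u (n + sval (cid e)) else y
      | inr i => u i end.
    apply/card_leTT; exists f => -[y|i] [y'|i'] /=.
    - case: pselect => [e|ne]; case: pselect => [e'|ne'].
      + move=> /uinj /addnI h1; congr inl.
        by apply: etrans (svalP (cid e)) _; rewrite h1 -(svalP (cid e')).
      + by move=> h1; case: ne'; eexists; symmetry; exact: h1.
      + by move=> h1; case: ne; eexists; exact: h1.
      + by move=> ->.
    - case: pselect => [e /uinj h1|ne h1]; last by case: ne; eexists; exact: h1.
      by move: (ltn_ord i'); rewrite -h1 ltnNge leq_addr.
    - case: pselect => [e /uinj h1|ne h1]; last by case: ne; eexists; symmetry; exact: h1.
      by move: (ltn_ord i); rewrite h1 ltnNge leq_addr.
    - by move=> /uinj /val_inj ->.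
  split; first exact: card_le_trans (card_le_trans TYn YnY) YK.
  by move=> KT; apply: nKY; apply: card_le_trans KT (card_le_trans TYn YnY).
have fYn : finite_set [set: Y + 'I_n].
  have -> : [set: Y + 'I_n] = (inl @` [set: Y]) `|` (inr @` [set: 'I_n]).
    by rewrite predeqE => -[y|i]; split=> // _; [left; exists y|right; exists i].
  by rewrite finite_setU; split; apply: finite_image => //; exact: finite_finset.
have fT := card_le_finite TYn fYn.
split; last by move=> KT; have /finite_setPn := fT; apply; apply: card_le_trans natK KT.
by apply: card_le_trans natK; apply: finite_set_countable.
Qed.

Section Transitivity.
Variables (L : language) (T : set (sentence L)) (M : structure L) (K : Type).
Hypothesis hM : monster T M K.
Variables (A : params M).
Hypothesis hA : small K A.
Variables (n : nat) (sigma : 'I_n -> sorts L).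

Let natK : [set: nat] #<= [set: K].
Proof.
have [h _] := monster_card hM; apply: card_le_trans h.
by apply/card_leTT; exists inr => x y [].
Qed.

(** Strong homogeneity is applied to [A] together with the entries of [a], each element being sent
    to the value of one of its names at [b]. *)
Lemma exists_automorphism (a b : tup M sigma) :
  (forall phi : pform (tvar sigma) A, psat (tup_env a) phi <-> psat (tup_env b) phi) ->
  exists g : forall s, M s -> M s, [/\ automorphism g,
    forall s (c : M s), @A s c -> g s c = c & forall i, g _ (a i) = b i].
Proof.
move=> ab.
pose B : params M := fun s c => @A s c \/ exists v : tvar sigma s, tup_env a v = c.
pose pe := param_env (B := A).
have hE s (c : param B s) : exists v : tvar sigma s + param A s,
    join_env (tup_env a) pe v = sval c.
  case: c => c [Ac|[v e]] /=; first by exists (inr (exist _ c Ac)).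
  by exists (inl v).
(* An element may have several names, variables or parameters. The choice is immaterial ([key]),
   since [a] and [b] satisfy the same equalities. *)
pose h s (c : param B s) := sval (cid (hE s c)).
have ha s c : join_env (tup_env a) pe (h s c) = sval c := svalP (cid (hE s c)).
have smallB : small K B.
  pose enc (c : {s : sorts L & param B s}) : {s : sorts L & param A s} + 'I_n :=
    match h (projT1 c) (projT2 c) with
    | inl v => inr (match v with TVar i => i end)
    | inr c' => inl (existT _ _ c') end.
  pose dec (z : {s : sorts L & param A s} + 'I_n) : {s : sorts L & M s} :=
    match z with inl c => existT _ (projT1 c) (sval (projT2 c))
               | inr i => existT _ (sigma i) (a i) end.
  have encK c : dec (enc c) = existT _ (projT1 c) (sval (projT2 c)).
    rewrite -ha /enc; case: c => s c /=; case: (h s c) => [v|c'] //=.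
    by case: v.
  apply: (@card_lt_add_finite _ _ _ n enc natK hA) => c c' /(congr1 dec).
  rewrite !encK; case: c c' => s [c Bc] [s' [c' Bc']] /= e.
  have inj (q q' : {s : sorts L & M s}) : q = q' -> forall Bq Bq',
      existT (param B) (projT1 q) (exist _ (projT2 q) Bq) =
      existT (param B) (projT1 q') (exist _ (projT2 q') Bq').
    by move=> -> Bq Bq'; rewrite (Prop_irrelevance Bq Bq').
  exact: (inj _ _ e Bc Bc').
pose f : env (param B) M := fun s c => join_env (tup_env b) pe (h s c).
have felem (phi : form (param B)) : sat (param_env (B := B)) phi <-> sat f phi.
  have -> : param_env (B := B) = fun s c => join_env (tup_env a) pe (h s c).
    by apply: env_eq => s c; rewrite ha.
  by rewrite -!sat_ren; apply: ab.
have [g gaut gf] := monster_homogeneous hM smallB felem.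
have key s (c : param B s) (v : tvar sigma s + param A s) :
    join_env (tup_env a) pe v = sval c -> f s c = join_env (tup_env b) pe v.
  move=> e; have /ab : psat (tup_env a) (Eq (Var (h s c)) (Var v)).
    by rewrite /psat /= ha e.
  by [].
exists g; split=> // [s c Ac|i].
  have Bc : B s c by left.
  by rewrite -[c in LHS]/(sval (exist _ c Bc)) gf (key _ _ (inr (exist _ c Ac))).
have Bc : B _ (a i) by right; exists (TVar sigma i).
by rewrite -[a i]/(sval (exist _ (a i) Bc)) gf (key _ _ (inl (TVar sigma i))).
Qed.

End Transitivity.

(** * Definable sets of finite families of tuples *)

Definition upd (I : eqType) (T : Type) (x : I -> T) (i0 : I) (z : T) : I -> T :=
  fun i => if i == i0 then z else x i.

Lemma upd_upd (I : eqType) (T : Type) (x : I -> T) i0 z z' :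
  upd (upd x i0 z) i0 z' = upd x i0 z'.
Proof. by apply/funext => i; rewrite /upd; case: eqP. Qed.

Lemma upd_id (I : eqType) (T : Type) (x : I -> T) i0 : upd x i0 (x i0) = x.
Proof. by apply/funext => i; rewrite /upd; case: eqP => // ->. Qed.

Section Families.
Variables (L : language) (M : structure L) (A : params M).
Variables (n : nat) (sigma : 'I_n -> sorts L).
Local Notation tup := (tup M sigma).

Definition tv (I : Type) (s : sorts L) : Type := (I * tvar sigma s)%type.

Definition tvenv (I : Type) (x : I -> tup) : env (tv I) M :=
  fun s v => tup_env (x v.1) v.2.

Definition adef (I : Type) (D : set (I -> tup)) : Prop :=
  exists phi : pform (tv I) A, forall x, D x <-> psat (tvenv x) phi.

Lemma adef_ext (I : Type) (D D' : set (I -> tup)) :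
  (forall x, D x <-> D' x) -> adef D -> adef D'.
Proof. by move=> e [phi h]; exists phi => x; rewrite -e h. Qed.

Lemma adef_imp (I : Type) (D D' : set (I -> tup)) :
  adef D -> adef D' -> adef (fun x => D x -> D' x).
Proof. by move=> [phi h] [psi h']; exists (Imp phi psi) => x; rewrite h h'. Qed.

Lemma adef_False (I : Type) : adef (fun _ : I -> tup => False).
Proof. by exists Bot. Qed.

Lemma adef_not (I : Type) (D : set (I -> tup)) : adef D -> adef (fun x => ~ D x).
Proof. by move=> h; apply: adef_imp h (adef_False I). Qed.

Lemma adef_True (I : Type) : adef (fun _ : I -> tup => True).
Proof. by apply: adef_ext (adef_not (adef_False I)) => x; split=> // _ []. Qed.

Lemma adef_and (I : Type) (D D' : set (I -> tup)) :
  adef D -> adef D' -> adef (fun x => D x /\ D' x).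
Proof.
move=> h h'; apply: adef_ext (adef_not (adef_imp h (adef_not h'))) => x.
split=> [nn|[d d'] nn]; last exact: nn d d'.
by split; apply: contrapT => nd; apply: nn.
Qed.

Lemma adef_or (I : Type) (D D' : set (I -> tup)) :
  adef D -> adef D' -> adef (fun x => D x \/ D' x).
Proof.
move=> h h'; apply: adef_ext (adef_imp (adef_not h) h') => x.
split=> [nn|[d|d'] nn //].
by case: (pselect (D x)) => d; [left|right; apply: nn].
Qed.

Lemma adef_all_lt (I : Type) (k : nat) (D : nat -> set (I -> tup)) :
  (forall i, i < k -> adef (D i)) -> adef (fun x => forall i, i < k -> D i x).
Proof.
elim: k => [|k IH] h; first by apply: adef_ext (adef_True I) => x; split.
have h1 := IH (fun i ik => h i (ltnW ik)).
apply: adef_ext (adef_and h1 (h k (ltnSn k))) => x; split=> [[h2 h3] i|h2].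
  by rewrite ltnS leq_eqVlt => /orP[/eqP->|]; [exact: h3|exact: h2].
by split=> [i ik|]; apply: h2 => //; apply: ltnW.
Qed.

Lemma adef_all_mem (I : Type) (J : eqType) (l : seq J) (D : J -> set (I -> tup)) :
  (forall j, adef (D j)) -> adef (fun x => forall j, j \in l -> D j x).
Proof.
move=> h; elim: l => [|j l IH]; first by apply: adef_ext (adef_True I) => x; split.
apply: adef_ext (adef_and (h j) IH) => x; split=> [[h2 h3] i|h2].
  by rewrite inE => /orP[/eqP->|]; [exact: h2|exact: h3].
by split=> [|i il]; apply: h2; rewrite inE ?eqxx // il orbT.
Qed.

Lemma adef_reindex (I J : Type) (h : I -> J) (D : set (I -> tup)) :
  adef D -> adef (fun y : J -> tup => D (y \o h)).
Proof.
move=> [phi hphi].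
exists (ren (fun s (v : tv I s + param A s) => match v with
  | inl w => inl (h w.1, w.2) | inr c => inr c end) phi) => y.
rewrite hphi /psat sat_ren.
suff -> : (fun s v => join_env (tvenv y) (param_env (B:=A)) match v with
    | inl w => inl (h w.1, w.2) | inr c => inr c end) =
  join_env (tvenv (y \o h)) (param_env (B:=A)) by [].
by apply: env_eq => s [].
Qed.

(** Coordinate [j] of the tuple [i0] is renamed to the newly bound variable; the cast identifies its
    sort with [sigma j]. *)
Lemma adef_forall_var (I : eqType) (i0 : I) (j : 'I_n) (D : set (I -> tup)) :
  adef D -> adef (fun x => forall a : M (sigma j), D (upd x i0 (dfwith (x i0) a))).
Proof.
move=> [phi hphi].
pose V := (fun s => tv I s + param A s)%type.
pose rho s (v : V s) : ext V (sigma j) s :=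
  match v with
  | inl (i, w) =>
      if i == i0 then
        match w in tvar _ s return ext V (sigma j) s with
        | TVar j' => if j =P j' is ReflectT e
            then ecast k (ext V (sigma j) (sigma k)) e (New V (sigma j))
            else Old (sigma j) (inl (i, TVar sigma j') : V (sigma j'))
        end
      else Old (sigma j) (inl (i, w) : V s)
  | inr c => Old (sigma j) (inr c : V s)
  end.
exists (All (ren rho phi)) => x; rewrite /psat /=.
suff E a : (fun s v => extend (join_env (tvenv x) (param_env (B:=A))) a (rho s v)) =
    join_env (tvenv (upd x i0 (dfwith (x i0) a))) (param_env (B:=A)).
  by split=> h a; have := h a; rewrite hphi sat_ren E.
apply: env_eq => s [[i w]|c] //=; rewrite /tvenv /upd /=.
case: eqP => // ->; case: w => j' /=; rewrite /dfwith.
by case: eqP => // e; case: j' / e.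
Qed.

(** A tuple is quantified one coordinate at a time; [l] lists the coordinates allowed to vary. *)
Lemma adef_forall (I : eqType) (i0 : I) (D : set (I -> tup)) :
  adef D -> adef (fun x => forall z, D (upd x i0 z)).
Proof.
move=> hD.
suff h (l : seq 'I_n) : adef (fun x => forall z : tup, (forall j, j \notin l -> z j = x i0 j) ->
    D (upd x i0 z)).
  apply: adef_ext (h (enum 'I_n)) => x; split=> hx z; last by move=> _; apply: hx.
  by apply: hx => j; rewrite mem_enum.
elim: l => [|j l IH].
  apply: adef_ext hD => x; split=> [Dx z e|]; last first.
    by move=> /(_ (x i0)); rewrite upd_id; apply.
  have -> : z = x i0 by apply: functional_extensionality_dep => j; apply: e.
  by rewrite upd_id.
apply: adef_ext (adef_forall_var i0 j IH) => x; split=> hx.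
  move=> z e; have := hx (z j) z; rewrite upd_upd; apply=> j' j'l.
  rewrite /upd eqxx; case: (eqVneq j j') => [<-|ne]; first by rewrite dfwith_in.
  by rewrite dfwith_out //; apply: e; rewrite inE negb_or eq_sym ne.
move=> a z e; rewrite upd_upd; apply: hx => j'; rewrite inE negb_or => /andP[ne j'l].
by rewrite e // /upd eqxx dfwith_out // eq_sym.
Qed.

Lemma adef_exists (I : eqType) (i0 : I) (D : set (I -> tup)) :
  adef D -> adef (fun x => exists z, D (upd x i0 z)).
Proof.
move=> hD; apply: adef_ext (adef_not (adef_forall i0 (adef_not hD))) => x.
split=> [h|[z Dz] h]; last exact: h z Dz.
by apply: contrapT => nex; apply: h => z Dz; apply: nex; exists z.
Qed.

Definition fam (I J : Type) (x : I -> tup) (z : J -> tup) : I + J -> tup :=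
  fun k => match k with inl i => x i | inr j => z j end.

Lemma adef_project (I : eqType) (J : finType) (i0 : I) (D : set (I + J -> tup)) :
  adef D -> adef (fun x : I -> tup => exists z : J -> tup, D (fam x z)).
Proof.
move=> hD.
have h (l : seq (I + J)%type) : adef (fun y : I + J -> tup => exists z : I + J -> tup,
    (forall k, k \notin l -> z k = y k) /\ D z).
  elim: l => [|k l IH].
    apply: adef_ext hD => y; split=> [Dy|[z [e Dz]]]; first by exists y.
    by have <- : z = y by apply/funext => k; apply: e.
  apply: adef_ext (adef_exists k IH) => y; split=> [[w [z [e Dz]]]|[z [e Dz]]].
    exists z; split=> // k'; rewrite inE negb_or => /andP[ne k'l].
    by rewrite e // /upd (negbTE ne).
  exists (z k), z; split=> // k' k'l; rewrite /upd; case: eqP => [->//|/eqP ne].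
  by apply: e; rewrite inE negb_or ne.
(* The slots [inr j] receive the value at [i0] as a placeholder and are then quantified away. *)
apply: adef_ext (adef_reindex (fun k => match k with inl i => i | inr _ => i0 end)
  (h [seq inr j | j <- enum J])) => x; split=> [[z [e Dz]]|[z Dz]].
  exists (z \o inr); suff -> : fam x (z \o inr) = z by [].
  apply/funext => -[i|j] //=; rewrite e //.
  by apply/mapP => -[].
exists (fam x z); split=> // -[i|j] //=.
by rewrite map_f ?mem_enum.
Qed.

End Families.

(** * Compactness *)

Section Compactness.
Variables (L : language) (T : set (sentence L)) (M : structure L) (K : Type).
Hypothesis hM : monster T M K.
Variables (A : params M).
Hypothesis hA : small K A.
Variables (n : nat) (sigma : 'I_n -> sorts L) (p : set (pform (tvar sigma) A)).
Hypothesis pC : complete_type p.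
Local Notation tup := (tup M sigma).

Lemma type_and phi psi : p phi -> p psi -> p (Neg (Imp phi (Neg psi))).
Proof.
move=> pphi ppsi; have [//|pn] := pC.2 (Neg (Imp phi (Neg psi))).
pose f (i : 'I_3) := nth phi [:: phi; psi; Neg (Neg (Imp phi (Neg psi)))] i.
have [|x hx] := pC.1 3 f; first by case=> -[|[|[|//]]].
have h0 := hx (@Ordinal 3 0 isT); have h1 := hx (@Ordinal 3 1 isT).
have h2 := hx (@Ordinal 3 2 isT).
by case: h2 => /= h2; exact: (h2 h0 h1).
Qed.

(** Families are flattened into single tuples so that saturation applies. The conditions that
    [theta] holds at every index, together with [D], generate a proper filter; the formulas in an
    ultrafilter above it form a complete type, and a realization gives the family. *)
Lemma compactness (I : finType) (D : set (I -> tup)) : adef A D ->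
  (forall theta, p theta ->
     exists x : I -> tup, (forall i, psat (tup_env (x i)) theta) /\ D x) ->
  exists x : I -> tup, (forall i, realizes p (x i)) /\ D x.
Proof.
move=> [rho hrho] hsat.
pose N := #|{: I * 'I_n}|.
pose sg (k : 'I_N) := sigma (enum_val k).2.
pose to (x : I -> tup) : Defs.tup M sg := fun k => x (enum_val k).1 (enum_val k).2.
pose c s (v : tv sigma I s) : tvar sg s :=
  match v.2 in tvar _ s return tvar sg s with
  | TVar j => ecast q (tvar sg (sigma q.2)) (enum_rankK (v.1, j))
                (TVar sg (enum_rank (v.1, j)))
  end.
pose from (y : Defs.tup M sg) : I -> tup := fun i j => tup_env y (c _ (i, TVar sigma j)).
have fromE y : tvenv (from y) = fun s v => tup_env y (c s v).
  by apply: env_eq => s [i v]; rewrite /tvenv /=; case: v.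
have toE x : (fun s v => tup_env (to x) (c s v)) = tvenv x.
  apply: env_eq => s [i v]; rewrite /tvenv /=; case: v => j.
  suff E q (e : enum_val (enum_rank (i, j)) = q) :
      tup_env (to x) (ecast q (tvar sg (sigma q.2)) e (TVar sg (enum_rank (i, j)))) =
      x q.1 q.2 by exact: (E _ (enum_rankK (i, j))).
  by case: q / e.
pose C (phi : pform (tv sigma I) A) : pform (tvar sg) A :=
  ren (fun s v => match v with inl w => inl (c s w) | inr a => inr a end) phi.
have satC y phi : psat (tup_env y) (C phi) <-> psat (tvenv (from y)) phi.
  rewrite /psat sat_ren; suff -> : (fun s v => join_env (tup_env y) (param_env (B:=A))
      match v with inl w => inl (c s w) | inr a => inr a end) =
    join_env (tvenv (from y)) (param_env (B:=A)) by [].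
  by apply: env_eq => s [v|v] //=; rewrite fromE.
have satCto x phi : psat (tup_env (to x)) (C phi) <-> psat (tvenv x) phi.
  by rewrite satC /psat fromE toE.
pose at_ i (phi : pform (tvar sigma) A) : pform (tv sigma I) A :=
  ren (fun s v => match v with inl w => inl (i, w) | inr a => inr a end) phi.
have satat x i phi : psat (tvenv x) (at_ i phi) <-> psat (tup_env (x i)) phi.
  rewrite /psat sat_ren; suff -> : (fun s v => join_env (tvenv x) (param_env (B:=A))
      match v with inl w => inl (i, w) | inr a => inr a end) =
    join_env (tup_env (x i)) (param_env (B:=A)) by [].
  by apply: env_eq => s [].
pose F : set_system (I -> tup) := fun S => exists2 theta, p theta &
  forall x, (forall i, psat (tup_env (x i)) theta) -> D x -> S x.
have FF : ProperFilter F.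
  split; first by move=> [theta pt h]; have [x [h1 h2]] := hsat _ pt; exact: h x h1 h2.
  split.
  - by have [h|h] := pC.2 Bot; [exists Bot|exists (Neg Bot)].
  - move=> S S' [t pt h] [t' pt' h']; exists (Neg (Imp t (Neg t'))).
      exact: type_and.
    have sp x i : psat (tup_env (x i)) (Neg (Imp t (Neg t'))) ->
        psat (tup_env (x i)) t /\ psat (tup_env (x i)) t'.
      by move=> nn; split; apply: contrapT => ns; apply: nn => //= ? ?.
    by move=> x hx Dx; split; [apply: h|apply: h'] => // i; case: (sp _ x i (hx i)).
  - by move=> S S' SS' [t pt h]; exists t => // x hx Dx; apply: SS'; apply: h.
have [U [UU FU]] := ultraFilterLemma FF.
pose q : set (pform (tvar sg) A) := fun phi => U [set x | psat (tup_env (to x)) phi].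
have qC : complete_type q.
  split=> [k phi qphi|phi].
    have key : U [set x | forall i, psat (tup_env (to x)) (phi i)].
      exact: (@filter_forall _ _ (fun i => [set x | psat (tup_env (to x)) (phi i)])).
    have [x hx] := filter_ex key.
    by exists (to x) => i; apply: (hx i).
  by have [h|h] := in_ultra_setVsetC [set x | psat (tup_env (to x)) phi] UU; [left|right].
have [y hy] := monster_saturated hM hA qC.
exists (from y); split=> [i phi pphi|].
  apply/(satat _ i phi)/satC; apply: hy; apply: FU; exists phi => // x hx _ /=.
  by apply/satCto; apply/(satat x i phi).
(* [p] contains [Bot] or [Neg Bot]; either one witnesses that [D] belongs to the filter. *)
apply/(hrho _)/satC; apply: hy; apply: FU; have [h|h] := pC.2 Bot.
  by exists Bot => // x _ Dx /=; apply/satCto/(hrho _).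
by exists (Neg Bot) => // x _ Dx /=; apply/satCto/(hrho _).
Qed.

End Compactness.

(** * Convex components and alternating chains *)

Section Components.
Variables (X : Type) (lt : set (X * X)).
Hypothesis ltO : strict_linear_order lt.
Let ltb : rel X := fun x y => `[< lt (x, y) >].
Let ltL : linear ltb := linear_asbool ltO.
Variable D : set X.

(** The convex component of [x] when [x] lies in [D]. *)
Definition component (x : X) : set X := [set y | forall z, between ltb x y z -> D z].

Lemma between_refl x z : between ltb x x z -> z = x.
Proof.
rewrite /between orbb => /andP[zx xz].
by case: (lin_le ltL zx) => // h; rewrite h in xz.
Qed.

Lemma between_right x y : between ltb x y y.
Proof.
rewrite /between !(negbTE (lin_irr ltL _)) /= andbT.
by case: (boolP (ltb y x)) => // /(lin_asym ltL) ->.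
Qed.

Lemma component_convex x : D x -> convex_component lt D (component x).
Proof.
move=> Dx; have xx : component x x by move=> z /between_refl ->.
split; first by exists x.
- by move=> y; apply; apply: between_right.
- move=> y z w Cy Cw /asboolP; rewrite -/(ltb y z) => yz /asboolP; rewrite -/(ltb z w) => zw.
  move=> v; rewrite /between => /orP[/andP[vx zv]|/andP[vz xv]].
    by apply: Cw; rewrite /between vx (lin_le_trans ltL zv (lin_asym ltL zw)).
  by apply: Cy; rewrite /between xv (lin_le_trans ltL (lin_asym ltL yz) vz) orbT.
- move=> C' C'D C'c sub; apply/seteqP; split=> // y C'y z.
  have conv u v w : C' u -> C' w -> ~~ ltb v u -> ~~ ltb w v -> C' v.
    move=> C'u C'w /(lin_le ltL)[<-//|/asboolP uv] /(lin_le ltL)[->//|/asboolP vw].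
    exact: C'c C'u C'w uv vw.
  by have C'x := sub _ xx; case/orP=> /andP[h1 h2]; apply: C'D;
    [exact: (conv x z y)|exact: (conv y z x)].
Qed.

Lemma component_neq x y z : ltb x z -> ltb z y -> ~ D z -> D y ->
  component x <> component y.
Proof.
move=> xz zy nDz Dy e.
have : component y y by move=> w /between_refl ->.
rewrite -e => /(_ z) h; apply: nDz; apply: h.
by rewrite /between (lin_asym ltL xz) (lin_asym ltL zy).
Qed.

(** Every second point of an alternating chain lies in [D], and the points outside [D] between them
    keep their components distinct. *)
Lemma finite_components_chains : finite_set [set C | convex_component lt D C] ->
  exists N, bounded_chains ltb (fun x => `[< D x >]) N.
Proof.
move=> /finite_set_leP[m hm]; exists (m.+1).*2 => b k u cu.
rewrite leqNgt; apply/negP => mk.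
(* Shifting by [~~ b] selects the positions of positive sign. *)
pose w i := u (i.*2 + ~~ b).
have wk i : i < m.+1 -> i.*2 + ~~ b < k.
  move=> im; apply: leq_ltn_trans mk; apply: (@leq_trans (i.*2).+1).
    by case: b {cu w}; rewrite ?addn0 ?addn1.
  by rewrite doubleS ltnS ltnW // ltnS leq_double -ltnS.
have Dw i : i < m.+1 -> D (w i).
  move=> im; apply/asboolP; rewrite (cu.1 _ (wk i im)).
  by rewrite oddD odd_double; case: b {cu w wk}.
have : `I_m.+1 #<= [set C | convex_component lt D C].
  have [h] : $|{injfun `I_m.+1 >-> [set C | convex_component lt D C]}|.
    apply/injfunPex; exists (component \o w).
      by move=> i im; apply/component_convex/Dw.
    move=> i i' im im' /=; rewrite !inE /= in im im' *.
    wlog ii' : i i' im im' / i < i'.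
      move=> H e; case: (ltngtP i i') => // h; first exact: H e.
      by apply/esym; apply: H (esym e).
    have lt1 : (i.*2 + ~~ b).+1 < i'.*2 + ~~ b.
      by rewrite -addSn ltn_add2r -doubleS leq_double.
    have k1 := ltn_trans lt1 (wk i' im').
    move=> /(@component_neq _ _ (u (i.*2 + ~~ b).+1)); case.
    - exact: (cu.2 _ k1).
    - exact: (chain_lt ltL cu lt1 (wk i' im')).
    - move=> /asboolP; rewrite (cu.1 _ k1) /= oddD odd_double.
      by case: b {cu w wk Dw lt1 k1}.
    - exact: Dw.
  exact: inj_card_le.
move=> h; have := card_le_trans h hm; by rewrite card_le_II ltnn.
Qed.

End Components.

(** * Relatively definable relations *)

Section Locus.
Variables (L : language) (T : set (sentence L)) (M : structure L) (K : Type).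
Hypothesis hM : monster T M K.
Variables (A : params M).
Hypothesis hA : small K A.
Variables (n : nat) (sigma : 'I_n -> sorts L) (p : set (pform (tvar sigma) A)).
Hypothesis pC : complete_type p.
Local Notation tup := (tup M sigma).
Local Notation locus := (locus p).

Definition pair_fam (x y : tup) (b : bool) : tup := if b then x else y.

Lemma adef_rel (I : Type) (k1 k2 : I) (R : set (tup * tup)) :
  definable2 A R -> adef A (fun x : I -> tup => R (x k1, x k2)).
Proof.
move=> [phi hphi].
exists (ren (fun s (v : (tvar sigma s + tvar sigma s) + param A s) => match v with
  | inl (inl w) => inl (k1, w) | inl (inr w) => inl (k2, w) | inr c => inr c end) phi) => x.
rewrite hphi /psat sat_ren.
suff -> : (fun s v => join_env (tvenv x) (param_env (B:=A)) match v with
    | inl (inl w) => inl (k1, w) | inl (inr w) => inl (k2, w) | inr c => inr c end) =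
  join_env (join_env (tup_env (x k1)) (tup_env (x k2))) (param_env (B:=A)) by [].
by apply: env_eq => s [[]|].
Qed.

Lemma rel_definable2P (R : set (locus * locus)) : rel_definable2 A R <->
  exists2 D, adef A D & forall x y, R (x, y) <-> D (pair_fam (sval x) (sval y)).
Proof.
split=> [[R' dR' e]|[D [phi hphi] e]].
  by exists (fun z : bool -> tup => R' (z true, z false)) => //; apply: adef_rel.
exists [set xy | D (pair_fam xy.1 xy.2)] => //.
exists (ren (fun s (v : tv sigma bool s + param A s) => match v with
  | inl w => inl (if w.1 then inl w.2 else inr w.2) | inr c => inr c end) phi) => x y.
rewrite /= hphi /psat sat_ren.
suff -> : (fun s v => join_env (join_env (tup_env x) (tup_env y)) (param_env (B:=A))
    match v with
    | inl w => inl (if w.1 then inl w.2 else inr w.2) | inr c => inr c end) =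
  join_env (tvenv (pair_fam x y)) (param_env (B:=A)) by [].
by apply: env_eq => s [[[]]|].
Qed.

Lemma rel_definable2_ext (R R' : set (locus * locus)) :
  (forall x y, R (x, y) <-> R' (x, y)) -> rel_definable2 A R -> rel_definable2 A R'.
Proof. by move=> e [S dS h]; exists S => // x y; rewrite -e h. Qed.

Lemma rel_definable2_or (R R' : set (locus * locus)) :
  rel_definable2 A R -> rel_definable2 A R' -> rel_definable2 A (R `|` R').
Proof.
move=> /rel_definable2P[D dD e] /rel_definable2P[D' dD' e']; apply/rel_definable2P.
exists (fun x => D x \/ D' x); first exact: adef_or.
by move=> x y; rewrite -e -e'.
Qed.

Lemma rel_definable2_not (R : set (locus * locus)) :
  rel_definable2 A R -> rel_definable2 A (~` R).
Proof.
move=> /rel_definable2P[D dD e]; apply/rel_definable2P.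
exists (fun x => ~ D x); first exact: adef_not.
by move=> x y; rewrite -e.
Qed.

Lemma rel_definable2_swap (R : set (locus * locus)) :
  rel_definable2 A R -> rel_definable2 A [set xy | R (xy.2, xy.1)].
Proof.
move=> /rel_definable2P[D dD e]; apply/rel_definable2P.
exists (fun x => D (x \o negb)); first exact: adef_reindex.
move=> x y; rewrite /= e.
by have -> : pair_fam (sval x) (sval y) \o negb = pair_fam (sval y) (sval x) by apply/funext => -[].
Qed.

Lemma rel_definable_section (R : set (locus * locus)) (a : locus) :
  rel_definable2 A R -> rel_definable (@allparams L M) [set x | R (a, x)].
Proof.
move=> [R' [phi hphi] e]; exists [set x | R' (sval a, x)]; last by move=> x; apply: e.
pose c s (d : M s) : param (@allparams L M) s := exist _ d Logic.I.
exists (ren (fun s (v : (tvar sigma s + tvar sigma s) + param A s) => match v with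
  | inl (inl w) => inr (c _ (tup_env (sval a) w))
  | inl (inr w) => inl w | inr d => inr (c _ (sval d)) end) phi) => x.
rewrite /= hphi /psat sat_ren.
suff -> : (fun s v => join_env (tup_env x) (param_env (B:=@allparams L M)) match v with
    | inl (inl w) => inr (c _ (tup_env (sval a) w))
    | inl (inr w) => inl w | inr d => inr (c _ (sval d)) end) =
  join_env (join_env (tup_env (sval a)) (tup_env x)) (param_env (B:=A)) by [].
by apply: env_eq => s [[]|].
Qed.

Lemma adef_at (I : Type) (k : I) (theta : pform (tvar sigma) A) :
  adef A (fun x : I -> tup => psat (tup_env (x k)) theta).
Proof.
exists (ren (fun s (v : tvar sigma s + param A s) => match v with
  | inl w => inl (k, w) | inr c => inr c end) theta) => x.
rewrite /psat sat_ren.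
suff -> : (fun s v => join_env (tvenv x) (param_env (B:=A)) match v with
    | inl w => inl (k, w) | inr c => inr c end) =
  join_env (tup_env (x k)) (param_env (B:=A)) by [].
by apply: env_eq => s [].
Qed.

(* Both a relation and its complement are projections of definable sets along
   the locus; compactness lets a single formula of [p] replace the locus. *)
Lemma separation (I J : finType) (D1 : set (bool + I -> tup)) (D2 : set (bool + J -> tup))
    (R : set (locus * locus)) : adef A D1 -> adef A D2 ->
  (forall x y, R (x, y) <->
     exists z : I -> locus, D1 (fam (pair_fam (sval x) (sval y)) (fun i => sval (z i)))) ->
  (forall x y, ~ R (x, y) <->
     exists z : J -> locus, D2 (fam (pair_fam (sval x) (sval y)) (fun i => sval (z i)))) ->
  rel_definable2 A R.
Proof.
move=> dD1 dD2 h1 h2.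
pose W := (bool + (I + J))%type.
pose i1 (k : bool + I) : W := match k with inl b => inl b | inr i => inr (inl i) end.
pose i2 (k : bool + J) : W := match k with inl b => inl b | inr i => inr (inr i) end.
pose D (x : W -> tup) := D1 (x \o i1) /\ D2 (x \o i2).
have dD : adef A D by apply: adef_and; apply: adef_reindex.
(* If no formula of [p] makes [D1] and [D2] incompatible, compactness yields a pair lying in both
   [R] and its complement. *)
have [[theta pt ht]|no] := pselect (exists2 theta, p theta & forall x : W -> tup,
    (forall k, psat (tup_env (x k)) theta) -> ~ D x); last first.
  have [|x [xp [Dx1 Dx2]]] := compactness hM hA pC dD.
    move=> theta pt; apply: contrapT => nex; apply: no; exists theta => // x hx Dx.
    by apply: nex; exists x.
  pose y k : locus := exist _ (x k) (xp k).
  case: ((h2 (y (inl true)) (y (inl false))).2).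
    exists (y \o inr \o inr).
    suff -> : fam (pair_fam (sval (y (inl true))) (sval (y (inl false))))
      (fun i => sval ((y \o inr \o inr) i)) = x \o i2 by [].
    by apply/funext => -[[]|].
  apply/h1; exists (y \o inr \o inl).
  suff -> : fam (pair_fam (sval (y (inl true))) (sval (y (inl false))))
    (fun i => sval ((y \o inr \o inl) i)) = x \o i1 by [].
  by apply/funext => -[[]|].
apply/rel_definable2P.
exists (fun y : bool -> tup => exists z : I -> tup,
  (forall i, i \in enum I -> psat (tup_env (z i)) theta) /\ D1 (fam y z)).
  have d : adef A (fun y : bool + I -> tup =>
      (forall i, i \in enum I -> psat (tup_env (y (inr i))) theta) /\ D1 y).
    by apply: adef_and dD1; apply: adef_all_mem => i; apply: adef_at.
  exact: (adef_project (I := bool) true d).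
move=> x y; split=> [/h1[z Dz]|[z [zt Dz]]].
  exists (fun i => sval (z i)); split=> // i _.
  exact: (svalP (z i)).
apply: contrapT => /h2[z' Dz'].
apply: (ht (fam (pair_fam (sval x) (sval y)) (fam z (fun j => sval (z' j))))).
  case=> [b|[i|j]] /=; last exact: (svalP (z' j)).
    by case: b; [exact: (svalP x)|exact: (svalP y)].
  by apply: zt; rewrite mem_enum.
split.
  suff -> : fam (pair_fam (sval x) (sval y)) (fam z (fun j => sval (z' j))) \o i1 =
    fam (pair_fam (sval x) (sval y)) z by [].
  by apply/funext => -[].
suff -> : fam (pair_fam (sval x) (sval y)) (fam z (fun j => sval (z' j))) \o i2 =
  fam (pair_fam (sval x) (sval y)) (fun j => sval (z' j)) by [].
by apply/funext => -[].
Qed.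

(** The properties of automorphisms over [A] on which the order-theoretic part rests. *)
Definition locus_map (h : locus -> locus) : Prop :=
  (forall y, exists x, h x = y) /\
  forall R, rel_definable2 A R -> forall x y, R (h x, h y) <-> R (x, y).

Lemma locus_inhabited : inhabited locus.
Proof. by have [x hx] := monster_saturated hM hA pC; exists; exists x. Qed.

Lemma locus_eq (x y : locus) : sval x = sval y -> x = y.
Proof. by case: x y => x xp [y yp] /= e; apply: eq_exist. Qed.

(** Completeness of [p] gives [a] and [b] the same formulas over [A]; an automorphism fixing [A] and
    carrying [a] to [b] restricts to the locus. *)
Lemma locus_transitive (a b : locus) : exists2 h, locus_map h & h a = b.
Proof.
have ab (phi : pform (tvar sigma) A) : psat (tup_env (sval a)) phi <-> psat (tup_env (sval b)) phi.
  have [pphi|pphi] := pC.2 phi.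
    by split=> _; [exact: (svalP b)|exact: (svalP a)].
  by split=> h; [case: (svalP a _ pphi)|case: (svalP b _ pphi)].
have [g [gaut gA gab]] := exists_automorphism hM hA ab.
pose gt (x : tup) : tup := fun i => g _ (x i).
have gtE x : tup_env (gt x) = fun s v => g s (tup_env x v).
  by apply: env_eq => s [].
have gsat x (phi : pform (tvar sigma) A) : psat (tup_env (gt x)) phi <-> psat (tup_env x) phi.
  rewrite /psat (_ : join_env (tup_env (gt x)) _ =
    (fun s v => g s (join_env (tup_env x) (param_env (B:=A)) v))); first exact: sat_aut.
  by apply: env_eq => s [v|[c Ac]]; rewrite ?gtE //= gA.
have greal x : realizes p (gt x) <-> realizes p x.
  by split=> h phi pphi; apply/gsat; apply: h.
pose h (x : locus) : locus := exist _ (gt (sval x)) ((greal _).2 (svalP x)).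
exists h; last first.
  by apply: locus_eq; apply: functional_extensionality_dep => i; apply: gab.
split=> [y|R [R' [phi hphi] e] x y].
  have ex i : exists c, g _ c = sval y i.
    by have [k _ gk] := aut_bij gaut (sigma i); exists (k (sval y i)).
  pose x : tup := fun i => sval (cid (ex i)).
  have xy : gt x = sval y.
    by apply: functional_extensionality_dep => i; apply: svalP (cid (ex i)).
  have xp : realizes p x by apply/greal; rewrite xy; apply: svalP.
  by exists (exist _ x xp); apply: locus_eq.
rewrite !e !hphi /psat (_ : join_env (join_env (tup_env (sval (h x))) _) _ =
  (fun s v => g s (join_env (join_env (tup_env (sval x)) (tup_env (sval y)))
    (param_env (B:=A)) v))); first exact: sat_aut.
by apply: env_eq => s [[v|v]|[c Ac]]; rewrite /= ?gtE //= gA.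
Qed.

End Locus.

(** * Application to weakly o-minimal pairs *)

Section WeaklyOMinimal.
Variables (L : language) (T : set (sentence L)) (M : structure L) (K : Type).
Hypothesis hM : monster T M K.
Variables (A : params M).
Hypothesis hA : small K A.
Variables (n : nat) (sigma : 'I_n -> sorts L) (p : set (pform (tvar sigma) A)).
Local Notation locus := (locus p).
Variable lt : set (locus * locus).
Hypothesis hlt : weakly_o_minimal_pair lt.
Let ltb : rel locus := fun x y => `[< lt (x, y) >].

Let pC : complete_type p. Proof. by case: hlt. Qed.
Let ltO : strict_linear_order lt. Proof. by case: hlt. Qed.
Let ltA : rel_definable2 A lt. Proof. by case: hlt. Qed.
Let ltL : linear ltb := linear_asbool ltO.
Let G := @locus_map L M A n sigma p.
Let Gtrans : forall a b, exists2 g, G g & g a = b := locus_transitive hM hA pC.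

Let Gsurj g : G g -> forall y, exists x, g x = y. Proof. by case. Qed.

Lemma locus_map_asbool (R : set (locus * locus)) g : rel_definable2 A R -> G g ->
  forall x y, `[< R (g x, g y) >] = `[< R (x, y) >].
Proof. by move=> dR [_ h] x y; apply/asboolP/asboolP => /(h R dR). Qed.

Let Glt g : G g -> forall x y, ltb (g x) (g y) = ltb x y.
Proof. exact: locus_map_asbool. Qed.

(** Weak o-minimality bounds the chains of one section; transitivity of [G] extends the bound to
    all. *)
Lemma section_chains (R : set (locus * locus)) : rel_definable2 A R ->
  exists N, forall m, bounded_chains ltb (fun x => `[< R (m, x) >]) N.
Proof.
move=> dR; have [a] := locus_inhabited hM hA pC.
have [_ _ _ /(_ _ (rel_definable_section a dR)) fin] := hlt.
have [N HN] := finite_components_chains ltO fin.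
exists N => m b k u [h1 h2]; have [g Gg ga] := Gtrans m a.
apply: (HN b k (g \o u)); split=> i ik /=; last by have := h2 i ik; rewrite -(Glt Gg).
by rewrite -ga -h1 //; apply: (locus_map_asbool dR Gg).
Qed.

(** For convexity, suppose [x < y < z] with [x] and [z] equivalent but not [y]. A longest
    alternating chain starting inside a class can be moved to start at [z] and prolonged by [x] and
    [y]. *)
Lemma definable_equivalence_ice E : definable_equivalences E ->
  ice ltb G (fun x y : locus => E (x, y)).
Proof.
move=> [[rE sE tE] dE]; have Einv g x y : G g -> E (x, y) <-> E (g x, g y).
  by move=> [_ h]; rewrite (h E dE).
split=> [//|//|//|y x z xy yz|]; first exact: tE xy yz.
move=> x y z xy yz xz; apply: contrapT => nxy.
have [N HN] := section_chains dE.
pose Q k := exists c u, chain ltb (fun w => `[< E (c, w) >]) true k u.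
have [] := @max_nat Q N.
- by exists 0, x, (fun=> x).
- by move=> k [c [u cu]]; apply: HN cu.
case=> [|k] [c [u cu]] kmax.
  suff /kmax : Q 1 by [].
  exists x, (fun=> x); split=> -[|i] // _.
  by rewrite addbF; apply/asboolP.
have [g Gg gz] := Gtrans (u 0) z.
have Ecu : E (c, u 0) by apply/asboolP; rewrite (cu.1 0 isT).
have Exgc : E (x, g c).
  by apply: (tE _ _ _ xz); rewrite -gz; apply: sE; rewrite -(Einv g c (u 0) Gg).
suff /kmax : Q k.+3 by rewrite ltnS ltnNge leqnSn.
exists x, (ucons x (ucons y (g \o u))).
apply: (@chain_cons _ _ _ false) => //; last by apply/asboolP.
apply: (@chain_cons _ _ _ true); last by rewrite /= gz.
- split=> i ik /=; last by rewrite (Glt Gg); apply: cu.2.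
  rewrite -[RHS]/(true (+) odd i) -(cu.1 i ik); apply/asboolP/asboolP => [h|h].
    by rewrite (Einv g) //; apply: (tE _ _ _ (sE _ _ Exgc) h).
  by apply: (tE _ _ _ Exgc); rewrite -(Einv g).
- by apply/asboolPn.
Qed.

Variable tri : set (locus * locus).
Hypothesis triO : strict_linear_order tri.
Hypothesis triA : rel_definable2 A tri.
Let trib : rel locus := fun x y => `[< tri (x, y) >].
Let triL : linear trib := linear_asbool triO.
Let Gtri g : G g -> forall x y, trib (g x) (g y) = trib x y.
Proof. exact: locus_map_asbool. Qed.

Let tri_chains : exists N, forall m, bounded_chains ltb (trib m) N.
Proof. exact: (section_chains triA). Qed.

Let tri_chains' : exists N, forall m, bounded_chains ltb (fun x => trib x m) N.
Proof. exact: (section_chains (rel_definable2_swap triA)). Qed.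

Definition signed (b : bool) (P : Prop) : Prop := if b then P else ~ P.

Lemma signedP (b : bool) (P : Prop) : `[< P >] = b <-> signed b P.
Proof.
case: b => /=; first by split=> /asboolP.
by split=> [/negbT/asboolPn|/asboolPn/negbTE].
Qed.

Lemma adef_signed (I : Type) b (D : set (I -> tup M sigma)) :
  adef A D -> adef A (fun x => signed b (D x)).
Proof. by case: b => // ; apply: adef_not. Qed.

(** By [not_levelP] the relation and its complement are both witnessed by chains of fixed length, so
    [separation] applies. *)
Lemma maximal_level_definable k j : maximal_level lt tri k -> 0 < j <= k ->
  rel_definable2 A [set xy | lt xy /\ level ltb trib j xy.1 xy.2].
Proof.
move=> [kmax kat] jk; have /andP[j0 _] := jk.
case: (ltA) => lt' dlt lt'E; case: (triA) => tri' dtri tri'E.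
have eqlt x y : lt (x, y) = lt' (sval x, sval y) by apply/propext/lt'E.
have eqtri x y : tri (x, y) = tri' (sval x, sval y) by apply/propext/tri'E.
pose m := (k - j).+1.
(* [chain_at l b x]: the tuples indexed by [inr (inord 0), ..., inr (inord l)]
   form an alternating chain as seen from [inl true] *)
pose chain_at l b (x : bool + 'I_l.+1 -> tup M sigma) :=
  (forall i, i < l.+1 -> signed (b (+) odd i) (tri' (x (inl true), x (inr (inord i))))) /\
  (forall i, i < l -> lt' (x (inr (inord i)), x (inr (inord i.+1)))).
have d_chain l b : adef A (@chain_at l b).
  apply: adef_and; apply: adef_all_lt => i _; last exact: adef_rel.
  by apply: adef_signed; apply: (adef_rel (inl true) (inr (inord i))).
have chain_atE l b (x y : locus) (z : 'I_l.+1 -> locus) :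
    chain_at l b (fam (pair_fam (sval x) (sval y)) (fun i => sval (z i))) <->
    chain ltb (trib x) b l.+1 (fun i => z (inord i)).
  split=> -[h1 h2]; split=> i il.
  - by apply/signedP; have := h1 i il; rewrite /= -eqtri.
  - by apply/asboolP; rewrite eqlt; apply: h2.
  - by rewrite /= -eqtri; apply/signedP; apply: h1.
  - by rewrite /= -eqlt; apply/asboolP; apply: h2.
have chain_inord l b (x : locus) u : chain ltb (trib x) b l.+1 u ->
    chain ltb (trib x) b l.+1 (fun i => u (inord i : 'I_l.+1)).
  by move=> [h1 h2]; split=> i il; rewrite !inordK // ?h1 ?h2 // ltnW.
(* [D1] uses [j] points, as [j.-1.+1 = j]; [D2] uses the [(k - j).+2] points of [not_levelP], or
   only the failure of [x < y]. *)
pose D1 (x : bool + 'I_j.-1.+1 -> tup M sigma) :=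
  chain_at j.-1 (~~ odd j) x /\
  (lt' (x (inl true), x (inl false)) /\ ~ lt' (x (inr (inord 0)), x (inl false))).
pose D2 (x : bool + 'I_m.+1 -> tup M sigma) :=
  ~ lt' (x (inl true), x (inl false)) \/
  (chain_at m (~~ odd k) x /\
   (lt' (x (inl true), x (inr (inord 0))) /\ ~ lt' (x (inl false), x (inr (inord m))))).
have d_lt l (k1 k2 : bool + 'I_l.+1) :
    adef A (fun x : bool + 'I_l.+1 -> tup M sigma => lt' (x k1, x k2)).
  exact: adef_rel.
apply: (@separation L T M K hM A hA n sigma p pC _ _ D1 D2).
- by apply: adef_and (d_chain _ _) _; apply: adef_and (d_lt _ _ _) (adef_not (d_lt _ _ _)).
- apply: adef_or; first exact: adef_not (d_lt _ _ _).
  apply: adef_and (d_chain _ _) _.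
  exact: adef_and (d_lt _ _ _) (adef_not (d_lt _ _ _)).
- move=> x y; rewrite /D1 /=; split=> [[xy [u cu yu]]|[z [/chain_atE cz [xy yz]]]].
    exists (fun i => u i); split.
      by apply/(chain_atE _ _ x y (fun i => u i))/chain_inord; rewrite prednK.
    rewrite /= -eqlt; split=> //; rewrite inordK // -eqlt => uy.
    by move: (yu j0) => /asboolP.
  split; first by rewrite eqlt.
  exists (fun i => z (inord i)); first by rewrite -{2}(prednK j0).
  by move=> _; apply/asboolPn; rewrite eqlt.
- move=> x y; rewrite /D2 /=; split=> [nR|].
    have [xy|nxy] := pselect (lt (x, y)); last first.
      by exists (fun=> x); left; rewrite /= -eqlt.
    have xyb : ltb x y by apply/asboolP.
    have nlv : ~ level ltb trib j x y by move=> lv; apply: nR.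
    have [u [cu xu uy]] := (not_levelP ltL Glt Gtri Gtrans kmax kat xyb jk).1 nlv.
    exists (fun i => u i); right; split.
      exact/(chain_atE _ _ x y (fun i => u i))/chain_inord.
    rewrite /= -!eqlt !inordK //; split; first exact/asboolP.
    by move: uy => /asboolP.
  move=> [z [nxy|[/chain_atE cz [xz zy]]]] [xy lv]; first by apply: nxy; rewrite -eqlt.
  have xyb : ltb x y by apply/asboolP.
  apply: ((not_levelP ltL Glt Gtri Gtrans kmax kat xyb jk).2 _ lv).
  exists (fun i => z (inord i)); split=> //; first by apply/asboolP; rewrite eqlt.
  by apply/asboolPn; rewrite eqlt.
Qed.

(** By linearity, equality means that neither [<] nor its converse holds, which avoids comparing
    coordinates. *)
Lemma id_definable : definable_equivalences (@id_rel locus).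
Proof.
split; first by split=> [x|x y /esym|x y z e e'] //; exact: (etrans e e').
apply: rel_definable2_ext (rel_definable2_not
  (rel_definable2_or ltA (rel_definable2_swap ltA))) => x y.
case: ltO => irr _ tot; split=> [/= nor|].
  by case: (tot x y) => // h; case: nor; [left|right].
by rewrite /id_rel /= => -> [/irr|/irr].
Qed.

Lemma level_definable k j : maximal_level lt tri k -> 0 < j <= k ->
  definable_equivalences (level_set lt tri j).
Proof.
move=> hk jk; have iE := levelrel_ice ltL triL Gsurj Glt Gtri Gtrans tri_chains tri_chains' j.
split.
  split=> [x|x y|x y z]; [exact: (ice_refl iE)|exact: (ice_sym iE)|exact: (ice_trans iE)].
have d := maximal_level_definable hk jk.
apply: rel_definable2_ext (rel_definable2_or id_definable.2
  (rel_definable2_or d (rel_definable2_swap d))) => x y.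
rewrite /level_set /=; split=> [[e|[[xy lv]|[yx lv]]]|[e|[/asboolP xy lv]|[/asboolP yx lv]]].
- by constructor 1.
- by constructor 2; split=> //; apply/asboolP.
- by constructor 3; split=> //; apply/asboolP.
- by left.
- by right; left.
- by right; right.
Qed.

Theorem representation_theorem :
  (exists! Es, is_representation lt tri (@definable_equivalences L M A n sigma p) Es) /\
  (forall Es, is_representation lt tri (@definable_equivalences L M A n sigma p) Es ->
     (same_orientation lt tri <-> last (@id_rel locus) Es <> setT)).
Proof.
have [k hk] := @maximal_level_exists _ lt tri tri_chains.
split.
  exists (level_seq lt tri k); split=> [|Es rep].
    exact: (level_seq_representation ltO triO Glt Gtri Gtrans id_definable level_definable hk).
  by rewrite (representation_unique ltO Glt Gtrans definable_equivalence_ice hk rep).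
move=> Es rep; have [_ _ + _] := rep; case: Es rep => // E Es rep [e].
rewrite {}e in rep *.
exact: (same_orientationE ltO triO Glt Gtrans definable_equivalence_ice rep).
Qed.

End WeaklyOMinimal.

Unset Implicit Arguments.

Theorem theorem3p2 (L : language) (T : set (sentence L))
    (hT : complete_theory T)
    (M : structure L) (K : Type) (hM : monster T M K)
    (A : params M) (hA : small K A)
    (n : nat) (sigma : 'I_n -> sorts L) (p : set (pform (tvar sigma) A))
    (lt : set (locus p * locus p)) (hlt : weakly_o_minimal_pair lt)
    (tri : set (locus p * locus p)) (htri : strict_linear_order tri)
    (htriA : rel_definable2 A tri) :
  let is_representation (Es : seq (set (locus p * locus p))) :=
    [/\ forall i : nat, (i < size Es)%N -> definable_equivalences (nth set0 Es i),
        strictly_increasing Es,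
        ohead Es = Some (@id_rel (locus p)) &
        tri = reverse_in_seq lt Es] in
  (exists! Es, is_representation Es) /\
  (forall Es, is_representation Es ->
     (same_orientation lt tri <-> last (@id_rel (locus p)) Es <> setT)).
Proof.
exact: (representation_theorem hM hA hlt htri htriA).
Qed.
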